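(* Let $E\subset\mathrm{LC}$ have $L^1_{loc}$-equicontinuous $m$-bounds, and let $\Theta=\{\theta^I_j\}$ be defined by $\theta^I_j(s)=\sup_{t\in I,\ f\in E}\int_t^{t+s}m^j_f(u)\,du$, where $m^j_f(t)=\sup_{x\in B_j}|f(t,x)|$ is the optimal $m$-bound of $f$ on $B_j$ (this is a suitable set of moduli of continuity). Let $B\subset\mathrm{WTC}_\Theta(\mathbb R^{N\times N})$ and $C\subset\mathrm{WTC}_\Theta(\mathbb R^N)$ both have $L^1_{loc}$-equicontinuous $m$-bounds. (i) If $(f_n)$ in $E$ converges to $f\in\mathrm{LC}$ in $\sigma_\Theta$ and $x_{0,n}\to x_0$ in $\mathbb R^N$, then $x(\cdot,f_n,x_{0,n})\to x(\cdot,f,x_0)$ uniformly on every compact interval $[T_1,T_2]\subset I_{f,x_0}$. (ii) If moreover $(F_n)$ in $B$ converges to $F$ in $(\mathrm{WTC}_\Theta(\mathbb R^{N\times N}),\sigma_\Theta)$, $(h_n)$ in $C$ converges to $h$ in $(\mathrm{WTC}_\Theta(\mathbb R^N),\sigma_\Theta)$, and $y_{0,n}\to y_0$ in $\mathbb R^N$, then $y(\cdot,f_n,F_n,h_n,x_{0,n},y_{0,n})\to y(\cdot,f,F,h,x_0,y_0)$ uniformly on every compact interval $[T_1,T_2]\subset I_{f,x_0}$.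
   Context: Notation: $|\cdot|$ is the Euclidean norm on $\mathbb R^N$ and $B_j$ the closed ball of $\mathbb R^N$ of radius $j$ centered at $0$. $L^1_{loc}$ denotes real functions on $\mathbb R$ integrable on every compact interval. For $f$ and $t\in\mathbb R$, $f_t(s,x)=f(s+t,x)$. A function $f:\mathbb R\times\mathbb R^N\to\mathbb R^M$ satisfies (C1) if it is Borel measurable, and (C2) if for every compact $K\subset\mathbb R^N$ there is $m^K\in L^1_{loc}$ (an $m$-bound of $f$ on $K$) with $|f(t,x)|\le m^K(t)$ for all $x\in K$ and a.e. $t$. $\mathrm{LC}$ is the set of $f:\mathbb R\times\mathbb R^N\to\mathbb R^N$ satisfying (C1), (C2) and: for each compact $K$ there is $l^K\in L^1_{loc}$ with $|f(t,x)-f(t,y)|\le l^K(t)|x-y|$ for $x,y\in K$, a.e. $t$. A suitable set of moduli of continuity is a countable family $\Theta=\{\theta^I_j\mid j\in\mathbb N,\ I=[q_1,q_2],\ q_1<q_2,\ q_1,q_2\in\mathbb Q\}$ of nondecreasing continuous functions $\theta^I_j:\mathbb R^+\to\mathbb R^+$ with $\theta^I_j(0)=0$ and $\theta^{I_1}_{j_1}\le\theta^{I_2}_{j_2}$ whenever $I_1\subseteq I_2$ and $j_1\le j_2$. $\mathcal K^I_j$ is the set of continuous $x:I\to B_j$ admitting $\theta^I_j$ as modulus of continuity. $\mathrm{WTC}_\Theta(\mathbb R^M)$ is the set of $f:\mathbb R\times\mathbb R^N\to\mathbb R^M$ satisfying (C1), (C2) and (W): for each $j$ and $I=[q_1,q_2]$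 with rational endpoints, if $x_n\in\mathcal K^I_j$ converge uniformly to $x\in\mathcal K^I_j$ then $\int_I f(t,x_n(t))dt\to\int_I f(t,x(t))dt$; functions differing only on a null subset of $\mathbb R^{1+N}$ are identified; $\mathrm{LC}\subset\mathrm{WTC}_\Theta(\mathbb R^N)$. $\sigma_\Theta$ is the topology generated by the seminorms $p_{I,j}(f)=\sup_{x\in\mathcal K^I_j}|\int_I f(t,x(t))\,dt|$. A set $S$ of nonnegative functions in $L^1_{loc}$ is $L^1_{loc}$-equicontinuous if for all $r,\varepsilon>0$ there is $\delta>0$ with $\sup_{m\in S}\int_s^t m<\varepsilon$ whenever $-r\le s\le t\le r$, $t-s<\delta$. A set $E$ has $L^1_{loc}$-equicontinuous $m$-bounds if for every $j\in\mathbb N$ there is an $L^1_{loc}$-equicontinuous set $S^j$ consisting of $m$-bounds on $B_j$ of the functions of $E$ (one for each function). For $f\in\mathrm{LC}$ and $x_0\in\mathbb R^N$, $x(\cdot,f,x_0)$ is the unique maximal solution of $\dot x=f(t,x)$, $x(0)=x_0$ (in the Carathéodory sense), defined on the maximal open interval $I_{f,x_0}$. For $F\in\mathrm{WTC}_\Theta(\mathbb R^{N\times N})$, $h\in\mathrm{WTC}_\Theta(\mathbb R^N)$, $y_0\in\mathbb R^N$, $y(\cdot,f,F,h,x_0,y_0)$ is the unique solution on $I_{f,x_0}$ of the linear problem $\dot y=F(t,x(t,f,x_0))\,y+h(t,x(t,f,x_0))$, $y(0)=y_0$. *)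

(* Defs.v *)
From HB Require Import structures.
From mathcomp Require Import all_boot all_order all_algebra.
From mathcomp Require Import all_classical all_reals all_analysis.
Set Implicit Arguments. Unset Strict Implicit. Unset Printing Implicit Defensive.
Import Order.TTheory GRing.Theory Num.Theory.
Import numFieldNormedType.Exports.
Local Open Scope classical_set_scope.
Local Open Scope ring_scope.

Section Defs.
Context {R : realType}.

Notation mu := (@lebesgue_measure R).

Definition enorm (p q : nat) (A : 'M[R]_(p, q)) : R :=
  Num.sqrt (\sum_(i < p) \sum_(j < q) A i j ^+ 2).

Definition ballj (N j : nat) : set 'cV[R]_N := [set x | enorm x <= j%:R].

Definition Lloc (m : R -> R) : Prop :=
  forall a b : R, a <= b -> mu.-integrable `[a, b] (EFin \o m).

Definition vint (p q : nat) (a b : R) (g : R -> 'M[R]_(p, q)) : 'M[R]_(p, q) :=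
  \matrix_(i, j) (\int[mu]_(t in `[a, b]) g t i j).

Definition vintegrable (p q : nat) (a b : R) (g : R -> 'M[R]_(p, q)) : Prop :=
  forall i j, mu.-integrable `[a, b] (fun t => (g t i j)%:E).

Definition oint (p q : nat) (a b : R) (g : R -> 'M[R]_(p, q)) : 'M[R]_(p, q) :=
  if a <= b then vint a b g else - vint b a g.

Definition borel_meas (T U : topologicalType) (g : T -> U) : Prop :=
  forall A : set U, open A -> (<<s open >> : set (set T)) (g @^-1` A).

Definition C1 (N p q : nat) (f : R -> 'cV[R]_N -> 'M[R]_(p, q)) : Prop :=
  borel_meas (fun tx : R * 'cV[R]_N => f tx.1 tx.2).

Definition mbound (N p q : nat) (f : R -> 'cV[R]_N -> 'M[R]_(p, q))
  (K : set 'cV[R]_N) (m : R -> R) : Prop :=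
  {ae mu, forall t, forall x, K x -> enorm (f t x) <= m t}.

Definition C2 (N p q : nat) (f : R -> 'cV[R]_N -> 'M[R]_(p, q)) : Prop :=
  forall K : set 'cV[R]_N, compact K -> exists m, Lloc m /\ mbound f K m.

Definition LC (N : nat) (f : R -> 'cV[R]_N -> 'cV[R]_N) : Prop :=
  [/\ C1 f, C2 f &
   forall K : set 'cV[R]_N, compact K -> exists l, Lloc l /\
     {ae mu, forall t, forall x y, K x -> K y ->
        enorm (f t x - f t y) <= l t * enorm (x - y)}].

(* a family of moduli indexed by I = [q1,q2] (rational endpoints) and j *)
Definition moduli := rat -> rat -> nat -> R -> R.

Definition Kset (N : nat) (Th : moduli) (q1 q2 : rat) (j : nat)
  (x : R -> 'cV[R]_N) : Prop :=
  [/\ {within `[ratr q1, ratr q2], continuous x},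
      (forall t, ratr q1 <= t <= ratr q2 -> ballj j (x t)) &
      (forall s t, ratr q1 <= s <= ratr q2 -> ratr q1 <= t <= ratr q2 ->
         enorm (x t - x s) <= Th q1 q2 j `|t - s|)].

Definition condW (N p q : nat) (Th : moduli) (f : R -> 'cV[R]_N -> 'M[R]_(p, q)) :=
  forall (q1 q2 : rat) (j : nat), q1 < q2 ->
  forall (xn : nat -> R -> 'cV[R]_N) (x : R -> 'cV[R]_N),
    (forall n, Kset Th q1 q2 j (xn n)) -> Kset Th q1 q2 j x ->
    (forall e : R, 0 < e -> \forall n \near \oo,
        forall t, ratr q1 <= t <= ratr q2 -> enorm (xn n t - x t) <= e) ->
    (forall e : R, 0 < e -> \forall n \near \oo,
        enorm (vint (ratr q1) (ratr q2) (fun t => f t (xn n t))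
               - vint (ratr q1) (ratr q2) (fun t => f t (x t))) <= e).

Definition WTC (N p q : nat) (Th : moduli) (f : R -> 'cV[R]_N -> 'M[R]_(p, q)) :=
  [/\ C1 f, C2 f & condW Th f].

(* convergence f_n -> f in sigma_Theta: p_{I,j}(f_n - f) -> 0 for every I, j *)
Definition sigma_cvg (N p q : nat) (Th : moduli)
  (fn : nat -> R -> 'cV[R]_N -> 'M[R]_(p, q)) (f : R -> 'cV[R]_N -> 'M[R]_(p, q)) :=
  forall (q1 q2 : rat) (j : nat), q1 < q2 ->
  forall e : R, 0 < e -> \forall n \near \oo,
    forall x, Kset Th q1 q2 j x ->
      enorm (vint (ratr q1) (ratr q2) (fun t => fn n t (x t) - f t (x t))) <= e.

Definition Lloc_equicont (S : set (R -> R)) : Prop :=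
  (forall m, S m -> Lloc m /\ forall t, 0 <= m t) /\
  forall r e : R, 0 < r -> 0 < e -> exists2 d : R, 0 < d &
    forall m, S m -> forall s t, -r <= s -> s <= t -> t <= r -> t - s < d ->
      \int[mu]_(u in `[s, t]) m u < e.

Definition eq_mbounds (N p q : nat) (E : set (R -> 'cV[R]_N -> 'M[R]_(p, q))) :=
  forall j : nat, exists mb : (R -> 'cV[R]_N -> 'M[R]_(p, q)) -> R -> R,
    (forall f, E f -> mbound f (ballj j) (mb f)) /\
    Lloc_equicont [set mb f | f in E].

Definition optbound (N p q : nat) (f : R -> 'cV[R]_N -> 'M[R]_(p, q)) (j : nat)
  (t : R) : R := sup [set enorm (f t x) | x in ballj j].

Definition ThetaE (N p q : nat) (E : set (R -> 'cV[R]_N -> 'M[R]_(p, q))) : moduli :=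
  fun q1 q2 j s => sup [set r | exists t f, [/\ ratr q1 <= t <= ratr q2, E f &
                         r = \int[mu]_(u in `[t, t + s]) optbound f j u]].

Definition is_sol (N : nat) (f : R -> 'cV[R]_N -> 'cV[R]_N) (x0 : 'cV[R]_N)
  (a b : \bar R) (x : R -> 'cV[R]_N) : Prop :=
  [/\ (a < 0%:E)%E, (0%:E < b)%E &
   forall t, (a < t%:E)%E -> (t%:E < b)%E ->
     vintegrable (Num.min 0 t) (Num.max 0 t) (fun s => f s (x s)) /\
     x t = x0 + oint 0 t (fun s => f s (x s))].

Definition is_max_sol (N : nat) (f : R -> 'cV[R]_N -> 'cV[R]_N) (x0 : 'cV[R]_N)
  (a b : \bar R) (x : R -> 'cV[R]_N) : Prop :=
  is_sol f x0 a b x /\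
  forall a' b' y, is_sol f x0 a' b' y ->
    [/\ (a <= a')%E, (b' <= b)%E &
        forall t, (a' < t%:E)%E -> (t%:E < b')%E -> y t = x t].

Definition is_lin_sol (N : nat) (G : R -> 'M[R]_N) (k : R -> 'cV[R]_N)
  (y0 : 'cV[R]_N) (a b : \bar R) (y : R -> 'cV[R]_N) : Prop :=
  forall t, (a < t%:E)%E -> (t%:E < b)%E ->
    vintegrable (Num.min 0 t) (Num.max 0 t) (fun s => G s *m y s + k s) /\
    y t = y0 + oint 0 t (fun s => G s *m y s + k s).

Definition mcvg (p q : nat) (u : nat -> 'M[R]_(p, q)) (l : 'M[R]_(p, q)) :=
  forall e : R, 0 < e -> \forall n \near \oo, enorm (u n - l) <= e.

Definition unif_cvg_on (N : nat) (an bn : nat -> \bar R)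
  (xn : nat -> R -> 'cV[R]_N) (x : R -> 'cV[R]_N) (T1 T2 : R) :=
  forall e : R, 0 < e -> \forall n \near \oo,
    [/\ (an n < T1%:E)%E, (T2%:E < bn n)%E &
        forall t, T1 <= t <= T2 -> enorm (xn n t - x t) <= e].

End Defs.

(* Main.v *)
Require Import Defs.
From HB Require Import structures.
From mathcomp Require Import all_boot all_order all_algebra.
From mathcomp Require Import all_classical all_reals all_analysis.
From mathcomp Require Import measurable_realfun ring lra.
Set Implicit Arguments. Unset Strict Implicit. Unset Printing Implicit Defensive.
Import Order.TTheory GRing.Theory Num.Theory.
Import numFieldNormedType.Exports.
Import HBNNSimple.
Local Open Scope classical_set_scope.
Local Open Scope ring_scope.

(** Instead of extracting convergent subsequences, solutions are compared
    directly.  Let x be the solution of the limit problem on a compact interval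
    with rational endpoints, and let pi be the coordinatewise projection onto a
    cube containing a neighbourhood of the range of x.  The truncated equation
    z' = f_n(t, pi z) has bounded, globally Lipschitz right-hand side, so Picard
    iteration gives a global solution z_n.  The curve pi z_n lies in K^I_j: its
    modulus of continuity is bounded by the integral of the optimal m-bound of
    f_n, which is what Theta was designed for.  Hence the integrals of
    (f_n - f)(t, pi z_n) over rational intervals tend to 0, and uniformly over
    all intervals by equicontinuity.  The Lipschitz condition on f and Gronwall's
    inequality then give z_n -> x uniformly; so z_n eventually stays in the cube,
    solves the original equation, and coincides with x_n by maximality.

    For the linear problems the same Gronwall argument applies with the m-bounds
    of F_n, since (F_n(t, x_n) - F(t, x)) y and h_n(t, x_n) - h(t, x) have
    uniformly small primitives: sigma_Theta convergence handles F_n - F along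
    x_n, condition (W) handles F(t, x_n) - F(t, x), and the uniformly continuous
    factor y is frozen on short intervals.

    The optimal m-bound is not known to be measurable; only lower integrals of
    it are used. *)

(** * Euclidean (Frobenius) norm of matrices *)

Section EuclideanNorm.
Context {R : realType}.

Lemma enorm_ge0 p q (A : 'M[R]_(p, q)) : 0 <= enorm A.
Proof. exact: sqrtr_ge0. Qed.

Lemma sum_sqr_ge0 p q (A : 'M[R]_(p, q)) :
  0 <= \sum_(i < p) \sum_(j < q) A i j ^+ 2.
Proof. by apply: sumr_ge0 => i _; apply: sumr_ge0 => j _; exact: sqr_ge0. Qed.

Lemma enorm_sqr p q (A : 'M[R]_(p, q)) :
  enorm A ^+ 2 = \sum_(i < p) \sum_(j < q) A i j ^+ 2.
Proof. by rewrite /enorm sqr_sqrtr// sum_sqr_ge0. Qed.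

Lemma enorm0 p q : enorm (0 : 'M[R]_(p, q)) = 0.
Proof.
rewrite /enorm (eq_bigr (fun=> 0)) ?sumr_const ?mul0rn ?sqrtr0// => i _.
by rewrite big1// => j _; rewrite mxE expr0n.
Qed.

Lemma enormN p q (A : 'M[R]_(p, q)) : enorm (- A) = enorm A.
Proof.
by rewrite /enorm; congr Num.sqrt; apply: eq_bigr => i _; apply: eq_bigr => j _;
  rewrite mxE sqrrN.
Qed.

Lemma enormBC p q (A B : 'M[R]_(p, q)) : enorm (A - B) = enorm (B - A).
Proof. by rewrite -enormN opprB. Qed.

Lemma entry_le_enorm p q (A : 'M[R]_(p, q)) i j : `|A i j| <= enorm A.
Proof.
rewrite -(@ler_pXn2r _ 2) ?nnegrE ?enorm_ge0// enorm_sqr.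
rewrite -normrX ger0_norm ?sqr_ge0//.
rewrite (bigD1 i)//= (bigD1 j)//= -addrA lerDl addr_ge0//.
- by apply: sumr_ge0 => *; exact: sqr_ge0.
- by apply: sumr_ge0 => *; apply: sumr_ge0 => *; exact: sqr_ge0.
Qed.

(** Summing the squares of [a * A i j - b * B i j] gives [key]. The weights a = |B|, b = |A|
    conclude when both norms are nonzero; otherwise a weight proportional to 1/S refutes S > 0. *)
Lemma frobenius_CauchySchwarz p q (A B : 'M[R]_(p, q)) :
  \sum_(i < p) \sum_(j < q) A i j * B i j <= enorm A * enorm B.
Proof.
set S := (X in X <= _).
have key (a b : R) : 2 * (a * b * S) <= a ^+ 2 * enorm A ^+ 2 + b ^+ 2 * enorm B ^+ 2.
  rewrite !enorm_sqr /S !mulr_sumr -big_split /=.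
  apply: ler_sum => i _; rewrite !mulr_sumr -big_split /=.
  apply: ler_sum => j _; have := sqr_ge0 (a * A i j - b * B i j).
  by rewrite !expr2; lra.
have [A0|A0] := eqVneq (enorm A) 0.
  rewrite A0 mul0r leNgt; apply/negP => S0.
  have := key ((enorm B ^+ 2 + 1) / S) 1.
  rewrite A0 expr0n /= mulr0 add0r expr1n !mul1r mulr1 divfK ?gt_eqF//.
  by have := sqr_ge0 (enorm B); lra.
have [B0|B0] := eqVneq (enorm B) 0.
  rewrite B0 mulr0 leNgt; apply/negP => S0.
  have := key 1 ((enorm A ^+ 2 + 1) / S).
  rewrite B0 expr0n /= mulr0 addr0 expr1n !mul1r divfK ?gt_eqF//.
  by have := sqr_ge0 (enorm A); lra.
have Ap : 0 < enorm A by rewrite lt_def A0 enorm_ge0.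
have Bp : 0 < enorm B by rewrite lt_def B0 enorm_ge0.
rewrite -(ler_pM2l (mulr_gt0 Bp Ap)).
by have := key (enorm B) (enorm A); rewrite !expr2; lra.
Qed.

Lemma enormD p q (A B : 'M[R]_(p, q)) : enorm (A + B) <= enorm A + enorm B.
Proof.
rewrite -(@ler_pXn2r _ 2) ?nnegrE ?addr_ge0 ?enorm_ge0//.
rewrite sqrrD !enorm_sqr.
have -> : \sum_(i < p) \sum_(j < q) (A + B) i j ^+ 2 =
  \sum_(i < p) \sum_(j < q) A i j ^+ 2 +
  (\sum_(i < p) \sum_(j < q) A i j * B i j) *+ 2 +
  \sum_(i < p) \sum_(j < q) B i j ^+ 2.
  rewrite -sumrMnl -!big_split /=; apply: eq_bigr => i _.
  rewrite -sumrMnl -!big_split /=; apply: eq_bigr => j _.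
  by rewrite mxE sqrrD.
by rewrite lerD2r lerD2l lerMn2r frobenius_CauchySchwarz orbT.
Qed.

Lemma enormB p q (A B : 'M[R]_(p, q)) : enorm (A - B) <= enorm A + enorm B.
Proof. by rewrite -[enorm B]enormN enormD. Qed.

Lemma enorm_sub_trans p q (A B C : 'M[R]_(p, q)) :
  enorm (A - C) <= enorm (A - B) + enorm (B - C).
Proof. by rewrite (le_trans _ (enormD _ _))// addrA subrK. Qed.

Lemma enorm_le_subD p q (A B : 'M[R]_(p, q)) : enorm A <= enorm (A - B) + enorm B.
Proof. by rewrite (le_trans _ (enormD _ _))// subrK. Qed.

Lemma enorm_le_sum p q (A : 'M[R]_(p, q)) :
  enorm A <= \sum_(i < p) \sum_(j < q) `|A i j|.
Proof.
rewrite -(@ler_pXn2r _ 2) ?nnegrE ?enorm_ge0//; last first.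
  by apply: sumr_ge0 => i _; apply: sumr_ge0.
rewrite enorm_sqr expr2 mulr_suml; apply: ler_sum => i _.
rewrite mulr_suml; apply: ler_sum => j _.
rewrite -real_normK ?num_real// expr2 ler_wpM2l//.
rewrite (bigD1 i)//= (bigD1 j)//= -addrA lerDl.
by rewrite addr_ge0// ?sumr_ge0// => ? _; apply: sumr_ge0.
Qed.

Lemma enorm_le0 p q (A : 'M[R]_(p, q)) : enorm A <= 0 -> A = 0.
Proof.
move=> A0; apply/matrixP => i j; rewrite mxE; apply/eqP.
by rewrite -normr_le0 (le_trans (entry_le_enorm _ _ _)).
Qed.

Lemma enorm_mulmx n p (A : 'M[R]_(n, p)) (v : 'cV[R]_p) :
  enorm (A *m v) <= enorm A * enorm v.
Proof.
rewrite -(@ler_pXn2r _ 2) ?nnegrE ?mulr_ge0 ?enorm_ge0//.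
rewrite exprMn !enorm_sqr mulr_suml; apply: ler_sum => i _.
rewrite big_ord1 mxE.
have CS := frobenius_CauchySchwarz ((row i A)^T) v.
have CS' := frobenius_CauchySchwarz (- (row i A)^T) v.
have eS : enorm (row i A)^T ^+ 2 = \sum_(j < p) A i j ^+ 2.
  by rewrite enorm_sqr; apply: eq_bigr => j _; rewrite big_ord1 !mxE.
rewrite -eS -enorm_sqr -exprMn -[leLHS]real_normK ?num_real// ler_pXn2r ?nnegrE ?mulr_ge0 ?enorm_ge0//.
have e1 : \sum_(j < p) A i j * v j ord0 =
    \sum_(k < p) \sum_(j < 1) (row i A)^T k j * v k j.
  by apply: eq_bigr => k _; rewrite big_ord1 !mxE.
have e2 : - \sum_(j < p) A i j * v j ord0 =
    \sum_(k < p) \sum_(j < 1) (- (row i A)^T) k j * v k j.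
  by rewrite -sumrN; apply: eq_bigr => k _; rewrite big_ord1 !mxE mulNr.
by rewrite ler_norml e1 CS andbT lerNl -e1 e2 -[enorm (row i A)^T]enormN.
Qed.

End EuclideanNorm.

(** * Compact balls, uniformly continuous curves and measurability along them *)

Section Curves.
Context {R : realType}.

(** Closed bounded sets of row vectors are compact; the transpose, being continuous, carries this
    over to columns. *)
Lemma ballj_compact N j : compact (@ballj R N j).
Proof.
pose K := [set v : 'rV[R]_N | enorm v^T <= j%:R].
have Kc : compact K.
  apply: bounded_closed_compact.
    exists j%:R; split; first exact: num_real.
    move=> M jM v /= Kv; rewrite [leLHS]/Num.Def.normr /= mx_normrE.
    apply/bigmax_leP; split=> [|ij _]; first by rewrite (le_trans _ (ltW jM)).
    rewrite (le_trans _ (ltW jM))// (le_trans _ Kv)//.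
    by have := entry_le_enorm v^T ij.2 ij.1; rewrite mxE.
  apply: (@closed_comp _ _ (fun v : 'rV[R]_N => enorm v^T) [set x | x <= j%:R]); last first.
    exact: closed_le.
  move=> v _; apply: (@continuous_comp _ _ _ (fun v : 'rV[R]_N =>
    \sum_(i < N) \sum_(k < 1) v^T i k ^+ 2) Num.sqrt); last first.
    exact: sqrt_continuous.
  have cs (I : finType) (F : I -> 'rV[R]_N -> R) : (forall i, {for v, continuous (F i)}) ->
      {for v, continuous (fun w => \sum_i F i w)}.
    move=> Fc; apply: (@cvg_big R I +%R 0 xpredT _ 'rV[R]_N (nbhs v)) => [|i _].
      exact: add_continuous.
    exact: Fc.
  apply: (cs) => i; apply: (cs) => k.
  apply: (@continuous_comp _ _ _ (fun v : 'rV[R]_N => v^T i k) (fun x => x ^+ 2)); last first.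
    exact: exprn_continuous.
  rewrite (_ : (fun v : 'rV[R]_N => v^T i k) = (fun v => v k i)); last first.
    by apply/funext => w; rewrite mxE.
  exact: coord_continuous.
have -> : @ballj R N j = trmx @` K.
  apply/seteqP; split=> [x xB|_ [v Kv <-]//].
  by exists x^T; rewrite /K /= trmxK.
apply: continuous_compact => //.
apply: continuous_subspaceT => v A /= [P vP PA].
exists (fun i k => P k i) => [i k|w Pw]; first by have := vP k i; rewrite mxE.
by apply: PA => i k; rewrite mxE.
Qed.

(** Uniform continuity is asked on the whole line: curves given on a compact interval are first
    extended by constants. *)
Definition ucont p q (z : R -> 'M[R]_(p, q)) :=
  forall e : R, 0 < e -> exists2 d : R, 0 < d &
    forall s t, `|t - s| < d -> enorm (z t - z s) <= e.

Lemma ucont_continuous p q (z : R -> 'M[R]_(p, q)) : ucont z -> continuous z.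
Proof.
move=> zu s A /nbhs_ballP[e /= e0 eA].
have [|d d0 zd] := zu (e / 2); first by rewrite divr_gt0.
apply/nbhs_ballP; exists d => //= t st; apply: eA; split=> // i j.
have := zd s t; rewrite distrC => /(_ st) zst.
rewrite /ball /= distrC; have := entry_le_enorm (z t - z s) i j.
rewrite !mxE => /le_lt_trans; apply; lra.
Qed.

(** The sets whose preimage under t |-> (t, z t) is measurable form a sigma-algebra containing the
    open sets, hence all Borel sets of the product. *)
Lemma borel_meas_curve p (U : topologicalType) (f : R * 'cV[R]_p -> U) (z : R -> 'cV[R]_p)
    (A : set U) : borel_meas f -> ucont z -> open A ->
  measurable [set t | A (f (t, z t))].
Proof.
move=> fB zu oA; pose G := image_set_system setT (fun t => (t, z t)) (@measurable _ R).
suff : <<s open >> `<=` G.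
  by move=> /(_ _ (fB _ oA)); rewrite /G /image_set_system /= setTI.
apply: smallest_sub.
  by apply: sigma_algebra_image; exact: sigma_algebra_measurable.
move=> B oB; rewrite /G /image_set_system /= setTI.
apply: open_measurable.
apply: open_comp => // t _.
by apply: (@cvg_pair _ _ _ (nbhs t) (nbhs t) (nbhs (z t)) _ _ _ id z) => //=; exact: ucont_continuous.
Qed.

Lemma C1_curve_measurable N p q (f : R -> 'cV[R]_N -> 'M[R]_(p, q)) z i j :
  C1 f -> ucont z -> measurable_fun setT (fun t => f t (z t) i j).
Proof.
move=> fC zu.
apply: (measurability (@RGenInftyO.G R)); first exact: RGenInftyO.measurableE.
move=> _ [_ [x ->] <-]; rewrite setTI.
have oA : open [set M : 'M[R]_(p, q) | M i j < x].
  apply: (@open_comp _ _ (fun M : 'M[R]_(p, q) => M i j) [set y | y < x]).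
    by move=> M _; exact: coord_continuous.
  exact: open_lt.
have := borel_meas_curve fC zu oA.
by congr (measurable _); apply/seteqP; split=> t /=; rewrite in_itv.
Qed.

End Curves.

(** * Integrals on intervals, dominated by possibly nonmeasurable bounds *)

Section Integration.
Context {R : realType}.
Notation mu := (@lebesgue_measure R).

(* No measurability is assumed: the integral of a nonnegative function is a
   supremum over the simple functions below it. *)
Lemma ge0_le_integral_nomeas (D D' : set R) (f g : R -> \bar R) : D `<=` D' ->
  (forall t, D t -> (0 <= f t)%E) -> (forall t, D' t -> (0 <= g t)%E) ->
  (forall t, D t -> (f t <= g t)%E) ->
  (\int[mu]_(t in D) f t <= \int[mu]_(t in D') g t)%E.
Proof.
move=> DD' f0 g0 fg; rewrite !ge0_integralE//; apply: ereal_sup_le => _ [h /= hf <-].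
exists h => // t; apply: le_trans (hf t) _; rewrite /= !patchE.
case: ifPn => [/set_mem Dt|_]; first by rewrite mem_set ?fg//; exact: DD'.
by case: ifPn => [/set_mem D't|_]; [exact: g0|].
Qed.

(** Deleting the exceptional null set and passing to the positive part of [psi] reduces this to a
    pointwise comparison of lower integrals. The integral of [H] must be finite because the
    real-valued integral sends +oo to 0. *)
Lemma le_Rintegral_nomeas (D : set R) (psi H : R -> R) : measurable D ->
  mu.-integrable D (EFin \o psi) -> (forall t, 0 <= H t) ->
  {ae mu, forall t, D t -> psi t <= H t} ->
  (\int[mu]_(t in D) (H t)%:E < +oo)%E ->
  \int[mu]_(t in D) psi t <= \int[mu]_(t in D) H t.
Proof.
move=> mD ipsi H0 [A [mA A0 NA]] Hoo.
have mDA : measurable (D `\` A) by exact: measurableD.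
have HD0 : (0 <= \int[mu]_(t in D) (H t)%:E)%E.
  by apply: integral_ge0 => t _; rewrite lee_fin.
have Hfin : (\int[mu]_(t in D) (H t)%:E \is a fin_num)%E by rewrite ge0_fin_numE.
rewrite /Rintegral fine_le//; first exact: integrable_fin_num.
rewrite (negligible_integral mA mD)//.
have ipsi' : mu.-integrable (D `\` A) (EFin \o psi).
  by apply: integrableS ipsi => // t [].
apply: (@le_trans _ _ (\int[mu]_(t in D `\` A) ((EFin \o psi)^\+ t))%E).
  apply: le_integral => //; first exact: integrable_funepos.
  by move=> t _; rewrite funeposE le_max lexx.
apply: ge0_le_integral_nomeas => [t []//|t _|t _|t [Dt At]]; rewrite ?lee_fin//.
rewrite funeposE /= ge_max !lee_fin H0 andbT.
by apply: contrapT => h; apply: At; apply: NA => /= /(_ Dt).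
Qed.

(** A simple function below [H] is a.e. below [m], and this compares measurable functions; the
    integral of [H] is the supremum over such simple functions. *)
Lemma ae_ge0_le_integral_nomeas (D : set R) (H m : R -> R) : measurable D ->
  (forall t, 0 <= H t) -> (forall t, 0 <= m t) -> mu.-integrable D (EFin \o m) ->
  {ae mu, forall t, D t -> H t <= m t} ->
  (\int[mu]_(t in D) (H t)%:E <= \int[mu]_(t in D) (m t)%:E)%E.
Proof.
move=> mD H0 m0 /measurable_int mm Hm; rewrite [leLHS]ge0_integralE => [|t _]; last by rewrite lee_fin.
apply: ge_ereal_sup => _ [h /= hH <-]; rewrite -integralT_nnsfun.
rewrite [leRHS]integral_mkcond; apply: ae_ge0_le_integral => //.
- by move=> t _; rewrite lee_fin; exact: fun_ge0.
- exact/measurable_EFinP.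
- by move=> t _; rewrite patchE; case: ifPn => _; rewrite ?lee_fin.
- exact/(measurable_restrictT _ _).1.
- case: Hm => A [mA A0 NA]; exists A; split => // t /= nt; apply: NA => /= Dt.
  apply: nt => _; have := hH t; rewrite !patchE; case: ifPn => // /set_mem /Dt Ht.
  by move=> /le_trans; apply; rewrite lee_fin.
Qed.

Lemma Rintegral_finsum (D : set R) (I : finType) (h : I -> R -> R) : measurable D ->
  (forall i, mu.-integrable D (EFin \o h i)) ->
  mu.-integrable D (EFin \o (fun t => \sum_i h i t)) /\
  \int[mu]_(t in D) (\sum_i h i t) = \sum_i \int[mu]_(t in D) h i t.
Proof.
move=> mD ih; elim: (index_enum I) => [|i s [IHi IHe]].
  split; last first.
    by under eq_Rintegral do rewrite big_nil; rewrite Rintegral_cst// mul0r big_nil.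
  apply: (@eq_integrable _ _ _ mu D mD (cst 0%E)) => [t _|]; last exact: integrable0.
  by rewrite /= big_nil.
have e : (fun t => \sum_(k <- i :: s) h k t) = (fun t => h i t + \sum_(k <- s) h k t).
  by apply/funext => t; rewrite big_cons.
rewrite e; split; last by rewrite RintegralD// IHe big_cons.
have := integrableD (mu := mu) mD (ih i) IHi.
by apply: eq_integrable => // t _ /=; rewrite EFinD.
Qed.

Lemma vintegrableS p q (a b s t : R) (g : R -> 'M[R]_(p, q)) : a <= s -> t <= b ->
  vintegrable a b g -> vintegrable s t g.
Proof.
move=> as_ tb ig i j; apply: integrableS (ig i j) => //.
by move=> u /=; rewrite !in_itv /= => /andP[su ut]; rewrite (le_trans as_ su) (le_trans ut).
Qed.

Lemma eq_vintegrable p q (a b : R) (g h : R -> 'M[R]_(p, q)) :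
  (forall t, a <= t <= b -> g t = h t) -> vintegrable a b g -> vintegrable a b h.
Proof.
move=> gh ig i j; apply: eq_integrable (ig i j) => // t.
by rewrite inE /= in_itv /= => /gh ->.
Qed.

Lemma eq_vint p q (a b : R) (g h : R -> 'M[R]_(p, q)) :
  (forall t, a <= t <= b -> g t = h t) -> vint a b g = vint a b h.
Proof.
move=> gh; apply/matrixP => i j; rewrite !mxE; apply: eq_Rintegral => t.
by rewrite inE /= in_itv /= => /gh ->.
Qed.

Lemma vintegrableD p q (a b : R) (g h : R -> 'M[R]_(p, q)) :
  vintegrable a b g -> vintegrable a b h -> vintegrable a b (fun t => g t + h t).
Proof.
move=> ig ih i j; have := integrableD (mu := mu) (measurable_itv _) (ig i j) (ih i j).
by apply: eq_integrable => // t _ /=; rewrite mxE EFinD.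
Qed.

Lemma vintegrableN p q (a b : R) (g : R -> 'M[R]_(p, q)) :
  vintegrable a b g -> vintegrable a b (fun t => - g t).
Proof.
move=> ig i j; have := integrableN (ig i j).
by apply: eq_integrable => // t _ /=; rewrite mxE EFinN.
Qed.

Lemma vintegrableB p q (a b : R) (g h : R -> 'M[R]_(p, q)) :
  vintegrable a b g -> vintegrable a b h -> vintegrable a b (fun t => g t - h t).
Proof. by move=> ig ih; apply: vintegrableD => //; exact: vintegrableN. Qed.

Lemma vintD p q (a b : R) (g h : R -> 'M[R]_(p, q)) :
  vintegrable a b g -> vintegrable a b h ->
  vint a b (fun t => g t + h t) = vint a b g + vint a b h.
Proof.
move=> ig ih; apply/matrixP => i j; rewrite !mxE -RintegralD//.
- by apply: eq_Rintegral => t _; rewrite mxE.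
- exact: ig.
- exact: ih.
Qed.

Lemma vintB p q (a b : R) (g h : R -> 'M[R]_(p, q)) :
  vintegrable a b g -> vintegrable a b h ->
  vint a b (fun t => g t - h t) = vint a b g - vint a b h.
Proof.
move=> ig ih; apply/matrixP => i j; rewrite !mxE -RintegralB//.
- by apply: eq_Rintegral => t _; rewrite !mxE.
- exact: ig.
- exact: ih.
Qed.

Lemma vint_mulmxr p q r (a b : R) (g : R -> 'M[R]_(p, q)) (v : 'M[R]_(q, r)) :
  vintegrable a b g -> vint a b (fun t => g t *m v) = vint a b g *m v.
Proof.
move=> ig; apply/matrixP => i j; rewrite !mxE.
under eq_Rintegral do rewrite mxE.
have igv k : mu.-integrable `[a, b] (EFin \o (fun t => g t i k * v k j)).
  have := integrableZr (mu := mu) (measurable_itv _) (v k j) (ig i k).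
  by apply: eq_integrable => // t _ /=; rewrite EFinM.
rewrite (Rintegral_finsum (measurable_itv _) igv).2.
apply: eq_bigr => k _; rewrite mxE RintegralZr//; exact: ig.
Qed.

Lemma Rintegral_cat (a s t : R) (h : R -> R) : a <= s -> s <= t ->
  mu.-integrable `[a, t] (EFin \o h) ->
  \int[mu]_(u in `[a, t]) h u =
  \int[mu]_(u in `[a, s]) h u + \int[mu]_(u in `[s, t]) h u.
Proof.
move=> as_ st ih.
have := Rintegral_itvB (x := s) ih; rewrite !bnd_simp => /(_ as_ st).
rewrite Rintegral_itv_obnd_cbnd; first by move=> <-; rewrite addrC subrK.
apply: integrableS ih => // u /=; rewrite !in_itv /= => /andP[/ltW su ->].
by rewrite (le_trans as_ su).
Qed.

Lemma vint_cat p q (a s t : R) (g : R -> 'M[R]_(p, q)) : a <= s -> s <= t ->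
  vintegrable a t g -> vint a t g = vint a s g + vint s t g.
Proof.
move=> as_ st ig; apply/matrixP => i j; rewrite !mxE.
by apply: Rintegral_cat => //; exact: ig.
Qed.

Lemma vint_set1 p q (a : R) (g : R -> 'M[R]_(p, q)) : vint a a g = 0.
Proof. by apply/matrixP => i j; rewrite !mxE set_itv1 Rintegral_set1. Qed.

(* Cauchy-Schwarz against the integral itself gives the sharp constant 1. *)
Lemma enorm_vint_le p q (a b : R) (g : R -> 'M[R]_(p, q)) (H : R -> R) :
  vintegrable a b g -> (forall t, 0 <= H t) ->
  (\int[mu]_(t in `[a, b]) (H t)%:E < +oo)%E ->
  {ae mu, forall t, a <= t <= b -> enorm (g t) <= H t} ->
  enorm (vint a b g) <= \int[mu]_(t in `[a, b]) H t.
Proof.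
move=> ig H0 Hoo gH; set v := vint a b g.
have [v0|v0] := eqVneq (enorm v) 0.
  by rewrite v0; apply: Rintegral_ge0 => t _; exact: H0.
have vp : 0 < enorm v by rewrite lt_def v0 enorm_ge0.
pose psi t := \sum_(k : 'I_p * 'I_q) (g t k.1 k.2 * (v k.1 k.2 / enorm v)).
have ik (k : 'I_p * 'I_q) :
    mu.-integrable `[a, b] (EFin \o (fun t => g t k.1 k.2 * (v k.1 k.2 / enorm v))).
  have := integrableZr (mu := mu) (measurable_itv _) (v k.1 k.2 / enorm v) (ig k.1 k.2).
  by apply: eq_integrable => // t _ /=; rewrite EFinM.
have [ipsi epsi] := Rintegral_finsum (measurable_itv _) ik.
have -> : enorm v = \int[mu]_(t in `[a, b]) psi t.
  rewrite epsi -[LHS](@mulfK _ (enorm v) v0) -expr2 enorm_sqr.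
  rewrite pair_bigA mulr_suml /=; apply: eq_bigr => k _.
  by rewrite RintegralZr//; [rewrite expr2 mulrA /v mxE|exact: ig].
apply: le_Rintegral_nomeas => //.
case: gH => A [mA A0 NA]; exists A; split => // t /= nt; apply: NA => /= gt.
apply: nt; rewrite in_itv /= => /gt; apply: le_trans.
rewrite /psi; under eq_bigr do rewrite mulrA.
rewrite -mulr_suml ler_pdivrMr// -(pair_bigA _ (fun i j => g t i j * v i j)) /=.
exact: frobenius_CauchySchwarz.
Qed.

Lemma ae_vintegrable p q (a b : R) (g : R -> 'M[R]_(p, q)) (m : R -> R) :
  (forall i j, measurable_fun setT (fun t => g t i j)) ->
  mu.-integrable `[a, b] (EFin \o m) ->
  {ae mu, forall t, a <= t <= b -> enorm (g t) <= m t} -> vintegrable a b g.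
Proof.
move=> mg /integrableP[mm im] gm i j.
have mgij : measurable_fun `[a, b] (fun t => g t i j).
  exact: measurable_funTS.
apply/integrableP; split; first exact/measurable_EFinP.
apply: le_lt_trans im; apply: ae_ge0_le_integral => //.
- by apply: measurableT_comp => //; exact/measurable_EFinP.
- exact: measurableT_comp.
case: gm => A [mA A0 NA]; exists A; split => // t /= nt; apply: NA => /= gt.
apply: nt; rewrite in_itv /= => /gt gmt.
by rewrite lee_fin (le_trans (entry_le_enorm _ _ _))// (le_trans gmt)// ler_norm.
Qed.

Lemma integrable_equicontinuous (a b : R) (h : R -> R) :
  mu.-integrable `[a, b] (EFin \o h) -> forall e : R, 0 < e ->
  exists2 d : R, 0 < d & forall s t, a <= s -> s <= t -> t <= b -> t - s < d ->
    \int[mu]_(u in `[s, t]) `|h u| < e.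
Proof.
move=> ih e e0.
have : mu.-integrable setT (EFin \o h \_ `[a, b]).
  by rewrite -restrict_EFin; apply/integrable_restrict => //=; rewrite setTI.
move=> /integral_normr_continuous /(_ _ e0)[d [d0 hd]].
exists d => // s t as_ st tb std.
rewrite (_ : \int[mu]_(u in `[s, t]) `|h u| =
  \int[mu]_(u in `[s, t]) `|(h \_ `[a, b]) u|).
  have : (mu `[s, t] < d%:E)%E.
    rewrite lebesgue_measure_itv /= lte_fin.
    by case: ifPn => // _; rewrite -EFinD lte_fin.
  by move=> /(hd _ (measurable_itv _)).
apply: eq_Rintegral => u; rewrite inE /= in_itv /= => /andP[su ut].
by rewrite patchE mem_set//= in_itv /= (le_trans as_ su) (le_trans ut tb).
Qed.

End Integration.

(** * A discrete Gronwall inequality *)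

Section Gronwall.
Context {R : realType}.
Notation mu := (@lebesgue_measure R).

Definition between (s t r : R) := Num.min s t <= r <= Num.max s t.

(** A step-function substitute for the exponential weight of Bielecki's norm, growing away from 0 in
    both directions. *)
Definition weight (d t : R) : R := 4 ^+ Num.truncn (`|t| / d).

Lemma weight_ge1 d t : 1 <= weight d t.
Proof. by rewrite /weight exprn_ege1// ler1n. Qed.

Lemma weight_le d t T : 0 < d -> `|t| <= T -> weight d t <= 4 ^+ Num.truncn (T / d).
Proof.
move=> d0 tT; rewrite /weight ler_weXn2l ?ler1n// le_truncn// ler_pM2r//.
by rewrite invr_gt0.
Qed.

(* The weight grows by 4 over each step of length d, so an increment of c/4 per
   step is absorbed into the factor 1/2. *)
Lemma weighted_step (a b d B c : R) (u v : R -> R) : a <= 0 -> 0 <= b -> 0 < d ->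
  0 <= B -> 0 <= c -> u 0 <= B ->
  (forall t, a <= t <= b -> v t <= c * weight d t) ->
  (forall s t k, a <= s <= b -> a <= t <= b -> `|t - s| <= d -> 0 <= k ->
     (forall r, between s t r -> v r <= k) -> u t <= u s + B + k / 4) ->
  forall t, a <= t <= b -> u t <= (c / 2 + 2 * B) * weight d t.
Proof.
move=> a0 b0 d0 B0 c0 u0 vc ust.
have vk k r : a <= r <= b -> `|r| < k.+1%:R * d -> v r <= c * 4 ^+ k.
  move=> rab rk; apply: le_trans (vc _ rab) _; rewrite ler_wpM2l//.
  rewrite /weight ler_weXn2l ?ler1n// truncn_le_nat ltr_pdivrMr//.
have p4 k : 1 <= 4 ^+ k :> R by rewrite exprn_ege1// ler1n.
suff P k t : a <= t <= b -> `|t| < k.+1%:R * d -> u t <= (c / 2 + 2 * B) * 4 ^+ k.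
  move=> t tab; apply: P => //; rewrite -ltr_pdivrMr//; exact: truncnS_gt.
elim: k t => [|k IH] t tab tk.
  have /= := ust 0 t c; rewrite a0 b0 subr0 => /(_ isT tab).
  rewrite expr0; move: tk; rewrite mul1r => tk /(_ (ltW tk) c0) h.
  have : u t <= u 0 + B + c / 4; last by lra.
  apply: h => r /andP[]; rewrite /between ge_min le_max => r1 r2.
  rewrite -[c]mulr1; have := @vk 0 r; rewrite expr0 mul1r; apply.
    by case/orP: r1 => ?; case/orP: r2 => ?; lra.
  by move: tk; rewrite !ltr_norml => ?; case/orP: r1 => ?; case/orP: r2 => ?; lra.
have [tk'|tk'] := ltP `|t| (k.+1%:R * d).
  apply: le_trans (IH _ tab tk') _; rewrite ler_wpM2l//; first lra.
  by rewrite ler_weXn2l ?ler1n.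
have kd : d <= k.+1%:R * d by rewrite ler_peMl ?ler1n// ltW.
have kS : k.+2%:R * d = k.+1%:R * d + d by rewrite -natr1 mulrDl mul1r.
(* [s] is t moved one step d towards 0: the induction hypothesis applies at [s], and v is at most c
   4^(k+1) between [s] and t. *)
have [s [sab sk sd sr]] : exists s, [/\ a <= s <= b, `|s| < k.+1%:R * d, `|t - s| <= d &
    forall r, between s t r -> a <= r <= b /\ `|r| < k.+2%:R * d].
  move: tk; rewrite kS.
  have [t0|t0] := leP 0 t.
    rewrite (ger0_norm t0) in tk' *; move=> tk; exists (t - d); split.
    - lra.
    - by rewrite ltr_norml; lra.
    - by rewrite ler_norml; lra.
    - by move=> r; rewrite /between min_l ?max_r ?ltr_norml; [lra|lra|lra].
  rewrite (ltr0_norm t0) in tk' *; move=> tk; exists (t + d); split.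
  - lra.
  - by rewrite ltr_norml; lra.
  - by rewrite ler_norml; lra.
  - by move=> r; rewrite /between min_r ?max_l ?ltr_norml; [lra|lra|lra].
have c4 : 0 <= c * 4 ^+ k.+1 by rewrite mulr_ge0// exprn_ge0.
have := ust s t (c * 4 ^+ k.+1) sab tab sd c4 (fun r br => vk _ _ (sr r br).1 (sr r br).2).
have := IH _ sab sk; have := p4 k; rewrite exprS; set W := 4 ^+ k => W1.
have : 0 <= c * W by rewrite mulr_ge0//; lra.
have : B <= B * W by rewrite ler_peMr.
rewrite !mulrDl; lra.
Qed.

Lemma le_geometric0 (x C : R) : (forall k, x <= C / 2 ^+ k) -> x <= 0.
Proof.
move=> xC; rewrite leNgt; apply/negP => x0.
have := xC (Num.truncn (C / x)).+1; apply/negP; rewrite -ltNge.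
rewrite ltr_pdivrMr ?exprn_gt0// mulrC -ltr_pdivrMr//.
apply: lt_trans (truncnS_gt _) _; rewrite -natrX ltr_nat; exact: ltn_expl.
Qed.

(** With v = u, [weighted_step] turns a bound c into c/2 + 2B, and iterating leads to the fixed
    point 4B. The a priori bound M only starts the iteration, which is why K depends on a, b and d
    alone. *)
Lemma gronwall (a b d : R) : a <= 0 -> 0 <= b -> 0 < d ->
  exists2 K : R, 0 < K & forall (u : R -> R) (B M : R), 0 <= B -> u 0 <= B ->
    (forall t, a <= t <= b -> u t <= M) ->
    (forall s t k, a <= s <= b -> a <= t <= b -> `|t - s| <= d -> 0 <= k ->
      (forall r, between s t r -> u r <= k) -> u t <= u s + B + k / 4) ->
    forall t, a <= t <= b -> u t <= K * B.
Proof.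
move=> a0 b0 d0; pose W := 4 ^+ Num.truncn ((b - a) / d) : R.
have W1 : 1 <= W by rewrite exprn_ege1// ler1n.
exists (4 * W) => [|u B M B0 u0 uM ust t tab]; first by rewrite mulr_gt0//; lra.
pose M' := Num.max M 0; have M0 : 0 <= M' by rewrite le_max lexx orbT.
have key k : forall t, a <= t <= b -> u t <= (4 * B + M' / 2 ^+ k) * weight d t.
  elim: k => [|k IH] r rab.
    rewrite expr0 divr1; apply: le_trans (uM _ rab) _.
    apply: (@le_trans _ _ M'); first by rewrite le_max lexx.
    have := weight_ge1 d r; set w := weight d r => w1.
    have : M' <= M' * w by rewrite ler_peMr.
    have : 0 <= B * w by rewrite mulr_ge0//; lra.
    by rewrite mulrDl; lra.
  have := weighted_step a0 b0 d0 B0 _ u0 IH ust rab.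
  have ck : 0 <= 4 * B + M' / 2 ^+ k by rewrite addr_ge0 ?mulr_ge0 ?invr_ge0 ?exprn_ge0.
  move=> /(_ ck); rewrite exprS invfM mulrA (_ : (_ + M' / 2 ^+ k) / 2 + 2 * B = 4 * B + M' / 2 / 2 ^+ k)//.
  by rewrite [M' / 2 / _]mulrAC; lra.
rewrite -subr_le0; apply: (@le_geometric0 _ (M' * W)) => k.
have := key k t tab.
have tW : weight d t <= W by apply: weight_le => //; rewrite ler_norml; lra.
have h1 : B * weight d t <= B * W by rewrite ler_wpM2l.
have h2 : M' / 2 ^+ k * weight d t <= M' / 2 ^+ k * W.
  by rewrite ler_wpM2l// mulr_ge0 ?invr_ge0 ?exprn_ge0.
rewrite mulrDl [M' * W / _]mulrAC; lra.
Qed.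

End Gronwall.

(** * Primitives extended to the whole line *)

Section Primitive.
Context {R : realType}.
Notation mu := (@lebesgue_measure R).

(** For a <= b, the nearest-point projection onto [a, b]. In time it extends curves by constants; in
    space, coordinatewise, it truncates to a cube. *)
Definition clamp (a b t : R) := Num.max a (Num.min b t).

Lemma clamp_itv a b t : a <= b -> a <= clamp a b t <= b.
Proof. by move=> ab; rewrite /clamp le_max lexx ge_max ab ge_min lexx. Qed.

Lemma clamp_id a b t : a <= t <= b -> clamp a b t = t.
Proof. by move=> /andP[a_t tb]; rewrite /clamp min_r// max_r. Qed.

Lemma clamp_lip a b s t : `|clamp a b t - clamp a b s| <= `|t - s|.
Proof.
have h (x y : R) : `|Num.min b x - Num.min b y| <= `|x - y|.
  have := ler_norm (x - y); have := ler_norm (y - x); rewrite [`|y - x|]distrC.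
  by case: (leP b x) => bx; case: (leP b y) => by_; rewrite ler_norml => *; apply/andP; lra.
have h' (x y : R) : `|Num.max a x - Num.max a y| <= `|x - y|.
  have := ler_norm (x - y); have := ler_norm (y - x); rewrite [`|y - x|]distrC.
  by case: (leP a x) => ax; case: (leP a y) => ay; rewrite ler_norml => *; apply/andP; lra.
exact: le_trans (h' _ _) (h _ _).
Qed.

(* The primitive of g vanishing at a, extended to the line by constants. *)
Definition prim p q (a b : R) (g : R -> 'M[R]_(p, q)) (t : R) :=
  vint a (clamp a b t) g.

Lemma prim_clamp p q a b (g : R -> 'M[R]_(p, q)) t : a <= b ->
  prim a b g (clamp a b t) = prim a b g t.
Proof. by move=> ab; rewrite /prim (clamp_id (clamp_itv t ab)). Qed.

Lemma prim_diff p q a b (g : R -> 'M[R]_(p, q)) s t : a <= s -> s <= t -> t <= b ->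
  vintegrable a b g -> prim a b g t - prim a b g s = vint s t g.
Proof.
move=> as_ st tb ig; rewrite /prim !clamp_id ?as_ ?(le_trans st)// ?(le_trans as_)//.
by rewrite (vint_cat as_ st); [rewrite addrC addKr|apply: vintegrableS ig].
Qed.

Lemma primB p q a b (g h : R -> 'M[R]_(p, q)) t : a <= b ->
  vintegrable a b g -> vintegrable a b h ->
  prim a b (fun u => g u - h u) t = prim a b g t - prim a b h t.
Proof.
move=> ab ig ih; have /andP[_ cb] := clamp_itv t ab.
by rewrite /prim vintB//; [apply: vintegrableS ig|apply: vintegrableS ih].
Qed.

Lemma primD p q a b (g h : R -> 'M[R]_(p, q)) t : a <= b ->
  vintegrable a b g -> vintegrable a b h ->
  prim a b (fun u => g u + h u) t = prim a b g t + prim a b h t.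
Proof.
move=> ab ig ih; have /andP[_ cb] := clamp_itv t ab.
by rewrite /prim vintD//; [apply: vintegrableS ig|apply: vintegrableS ih].
Qed.

Lemma eq_prim p q a b (g h : R -> 'M[R]_(p, q)) t : a <= b ->
  (forall t, a <= t <= b -> g t = h t) -> prim a b g t = prim a b h t.
Proof.
move=> ab gh; have /andP[_ cb] := clamp_itv t ab.
by apply: eq_vint => r /andP[ar rc]; apply: gh; rewrite ar (le_trans rc).
Qed.

Lemma integrable_subitv (a b s t : R) (m : R -> R) : a <= s -> t <= b ->
  mu.-integrable `[a, b] (EFin \o m) -> mu.-integrable `[s, t] (EFin \o m).
Proof.
move=> as_ tb; apply: integrableS => // u /=.
by rewrite !in_itv /= => /andP[su ut]; rewrite (le_trans as_ su) (le_trans ut).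
Qed.

Lemma enorm_prim_le p q a b (g : R -> 'M[R]_(p, q)) (m : R -> R) s t :
  a <= s <= b -> a <= t <= b -> vintegrable a b g ->
  (forall r, 0 <= m r) -> mu.-integrable `[a, b] (EFin \o m) ->
  {ae mu, forall r, a <= r <= b -> between s t r -> enorm (g r) <= m r} ->
  enorm (prim a b g t - prim a b g s) <=
  \int[mu]_(u in `[Num.min s t, Num.max s t]) m u.
Proof.
move=> sab tab ig m0 im gm.
wlog st : s t sab tab gm / s <= t => [hw|].
  have [st|/ltW ts] := leP s t.
    by have := hw s t sab tab gm st; rewrite min_l// max_r.
  have := hw t s tab sab; rewrite /between minC maxC min_r// max_l// enormBC.
  by apply=> //; move: gm; rewrite /between min_r// max_l.
move: gm; rewrite /between min_l// max_r// => gm.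
have [as_ tb] : a <= s /\ t <= b by lra.
rewrite (prim_diff as_ st tb ig); apply: enorm_vint_le => //.
- exact: vintegrableS ig.
- by apply: integrable_lty => //; exact: integrable_subitv im.
case: gm => A [mA A0 NA]; exists A; split => // r /= nr; apply: NA => /= gr.
by apply: nr => rst; apply: gr => //; lra.
Qed.

(** Clamping does not increase distances, and the integrable sum of the absolute entries of [g]
    dominates its norm; absolute continuity of the integral gives the modulus. *)
Lemma prim_ucont p q a b (g : R -> 'M[R]_(p, q)) : a <= b ->
  vintegrable a b g -> ucont (prim a b g).
Proof.
move=> ab ig e e0.
pose m t := \sum_(k : 'I_p * 'I_q) `|g t k.1 k.2|.
have m0 t : 0 <= m t by apply: sumr_ge0.
have im : mu.-integrable `[a, b] (EFin \o m).
  apply: (Rintegral_finsum (measurable_itv _) _).1 => k.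
  exact: integrable_norm (ig k.1 k.2).
have [d d0 md] := integrable_equicontinuous im e0.
exists d => // s t std; rewrite -(prim_clamp g s ab) -(prim_clamp g t ab).
have sab := clamp_itv s ab; have tab := clamp_itv t ab.
have := le_lt_trans (clamp_lip a b s t) std.
move: (clamp a b s) (clamp a b t) sab tab => {std}s {}t sab tab std.
apply: le_trans (enorm_prim_le sab tab ig m0 im _) _.
  apply: aeW => r _ _; apply: le_trans (enorm_le_sum _) _.
  by rewrite pair_bigA.
have {}md r1 r2 : a <= r1 -> r1 <= r2 -> r2 <= b -> r2 - r1 < d ->
    \int[mu]_(u in `[r1, r2]) m u <= e.
  move=> h1 h2 h3 h4; apply: le_trans (ltW (md _ _ h1 h2 h3 h4)).
  by under [leRHS]eq_Rintegral do rewrite ger0_norm//.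
by move: std; rewrite ltr_norml => std; case: (leP s t) => st; apply: md; lra.
Qed.

(** Removes from the integral equations the case distinction on the sign of t. *)
Lemma oint_prim p q a b (g : R -> 'M[R]_(p, q)) t : a <= 0 -> 0 <= b ->
  a <= t <= b -> vintegrable a b g ->
  oint 0 t g = prim a b g t - prim a b g 0.
Proof.
move=> a0 b0 /andP[a_t tb] ig; rewrite /oint; case: leP => t0.
  by rewrite (prim_diff _ _ _ ig).
by rewrite -(prim_diff _ _ _ ig)// ?opprB// ltW.
Qed.

Lemma vintegrable_cat p q (a b c : R) (g : R -> 'M[R]_(p, q)) : a <= b -> b <= c ->
  vintegrable a b g -> vintegrable b c g -> vintegrable a c g.
Proof.
move=> ab bc i1 i2 i j.
have : mu.-integrable (`[a, b] `|` `[b, c]) (fun t => (g t i j)%:E).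
  have /integrableP[m1 f1] := i1 i j; have /integrableP[m2 f2] := i2 i j.
  have mU : measurable_fun (`[a, b] `|` `[b, c]) (fun t => (g t i j)%:E).
    exact/measurable_funU.
  apply/integrableP; split; first exact: mU.
  apply: le_lt_trans (_ : _ <= \int[mu]_(t in `[a, b]) `|(g t i j)%:E| +
    \int[mu]_(t in `[b, c]) `|(g t i j)%:E|)%E _; last by rewrite lte_add_pinfty.
  rewrite -(@setDUK _ `[a, b]%classic (`[a, b] `|` `[b, c])%classic); last by move=> ?; left.
  rewrite ge0_integral_setU//.
  - rewrite leeD2l//; apply: ge0_le_integral_nomeas => // t [[]//].
  - by apply: measurableD => //; exact: measurableU.
  - rewrite setDUK; last by move=> ?; left.
    exact: measurableT_comp mU.
  - by apply/disj_setPS => t [? []].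
apply: integrableS => //; first exact: measurableU.
move=> t /=; rewrite !in_itv /= => /andP[a_t tc].
by have [tb|/ltW bt] := leP t b; [left|right]; rewrite ?a_t ?bt.
Qed.

Lemma ucont_cst p q (A : 'M[R]_(p, q)) : ucont (fun=> A).
Proof. by move=> e e0; exists 1 => // s t _; rewrite subrr enorm0 ltW. Qed.

Lemma ucontD p q (y z : R -> 'M[R]_(p, q)) : ucont y -> ucont z ->
  ucont (fun t => y t + z t).
Proof.
move=> yu zu e e0; have e2 : 0 < e / 2 by rewrite divr_gt0.
have [d1 d10 y1] := yu _ e2; have [d2 d20 z2] := zu _ e2.
exists (Num.min d1 d2) => [|s t]; first by rewrite lt_min d10.
rewrite lt_min => /andP[/y1 h1 /z2 h2].
by rewrite opprD addrACA (le_trans (enormD _ _))//; lra.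
Qed.

Lemma ucont_lim p q (z : R -> 'M[R]_(p, q)) (Z : nat -> R -> 'M[R]_(p, q)) :
  (forall k, ucont (Z k)) ->
  (forall e : R, 0 < e -> exists k, forall t, enorm (Z k t - z t) <= e) -> ucont z.
Proof.
move=> Zu Zz e e0; have [|k Zk] := Zz (e / 3); first by rewrite divr_gt0.
have [|d d0 Zd] := Zu k (e / 3); first by rewrite divr_gt0.
exists d => // s t /Zd h.
have := enorm_sub_trans (z t) (Z k t) (z s); have := enorm_sub_trans (Z k t) (Z k s) (z s).
by have := Zk s; have := Zk t; rewrite (enormBC (z t) (Z k t)); lra.
Qed.

End Primitive.

(** * Picard iteration with a time-dependent integrable Lipschitz factor *)

Section Picard.
Context {R : realType}.
Notation mu := (@lebesgue_measure R).

(** The intervals of centre [w k] and radius 2C/2^k are nested; L is the supremum of their left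
    ends. *)
Lemma geometric_limit (w : nat -> R) (C : R) :
  (forall k, `|w k.+1 - w k| <= C / 2 ^+ k) ->
  exists L, forall k, `|w k - L| <= 2 * C / 2 ^+ k.
Proof.
move=> wC; pose c k := 2 * C / 2 ^+ k.
have cS k : c k = C / 2 ^+ k + c k.+1.
  by rewrite /c exprS; field; rewrite expf_neq0.
have c0 k : 0 <= c k.
  by have := wC k; have := normr_ge0 (w k.+1 - w k); rewrite /c; lra.
have step k : w k - c k <= w k.+1 - c k.+1 /\ w k.+1 + c k.+1 <= w k + c k.
  by have := wC k; rewrite ler_norml (cS k); lra.
have lo k n : w k - c k <= w (k + n)%N - c (k + n)%N.
  elim: n => [|n IH]; rewrite ?addn0// addnS.
  by rewrite (le_trans IH)//; have [] := step (k + n)%N.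
have up k n : w (k + n)%N + c (k + n)%N <= w k + c k.
  elim: n => [|n IH]; rewrite ?addn0// addnS.
  by rewrite (le_trans _ IH)//; have [] := step (k + n)%N.
have lu n k : w n - c n <= w k + c k.
  have := lo n k; have := up k n; rewrite addnC; have := c0 (n + k)%N; lra.
pose S := range (fun k => w k - c k).
have S0 : S !=set0 by exists (w 0 - c 0); exists 0.
have Sub k : ubound S (w k + c k) by move=> _ [n _ <-]; exact: lu.
exists (sup S) => k; rewrite ler_norml -/(c k).
have := ge_sup S0 (Sub k); have : w k - c k <= sup S.
  by apply: ub_le_sup; [exists (w k + c k)|exists k].
lra.
Qed.

Lemma geometric_limit_mx p q (Z : nat -> R -> 'M[R]_(p, q)) (C : R) :
  (forall k t, enorm (Z k.+1 t - Z k t) <= C / 2 ^+ k) ->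
  exists z C', forall k t, enorm (Z k t - z t) <= C' / 2 ^+ k.
Proof.
move=> ZC.
have /choice[L LP] : forall tij : R * ('I_p * 'I_q), exists l, forall k,
    `|Z k tij.1 tij.2.1 tij.2.2 - l| <= 2 * C / 2 ^+ k.
  move=> [t [i j]] /=; apply: geometric_limit => k; apply: le_trans (ZC k t).
  by have := entry_le_enorm (Z k.+1 t - Z k t) i j; rewrite !mxE.
exists (fun t => \matrix_(i, j) L (t, (i, j))).
exists (\sum_(i < p) \sum_(j < q) (2 * C)) => k t.
apply: le_trans (enorm_le_sum _) _; rewrite mulr_suml; apply: ler_sum => i _.
rewrite mulr_suml; apply: ler_sum => j _; rewrite !mxE.
exact: (LP (t, (i, j))).
Qed.

Lemma exists_geometric_lt (C e : R) : 0 < e -> exists k : nat, C / 2 ^+ k <= e.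
Proof.
move=> e0; apply: contrapT => h.
have : e <= 0; last by rewrite leNgt e0.
apply: (@le_geometric0 _ _ C) => k; rewrite leNgt; apply/negP => hk.
by apply: h; exists k; exact: ltW.
Qed.

Lemma ae_mono (P Q : R -> Prop) : (forall t, P t -> Q t) ->
  {ae mu, forall t, P t} -> {ae mu, forall t, Q t}.
Proof.
move=> PQ [A [mA A0 PA]]; exists A; split => // t /= nQ; apply: PA => /= Pt.
by apply: nQ; exact: PQ.
Qed.

Lemma ae_mono2 (P Q S : R -> Prop) : (forall t, P t -> Q t -> S t) ->
  {ae mu, forall t, P t} -> {ae mu, forall t, Q t} -> {ae mu, forall t, S t}.
Proof.
move=> PQS [A [mA A0 PA]] [B [mB B0 QB]]; exists (A `|` B); split.
- exact: measurableU.
- by rewrite measureU0.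
move=> t /= nS; apply: contrapT => nAB; apply: nS; apply: PQS.
- by apply: contrapT => nP; apply: nAB; left; exact: PA.
- by apply: contrapT => nQ; apply: nAB; right; exact: QB.
Qed.

(** [G] acts on whole curves, so each null set may depend on the curves. As [l] has mass at most 1/4
    on short intervals, each Picard step halves the increments in the weighted norm. *)
Lemma picard N (a b : R) (G : (R -> 'cV[R]_N) -> R -> 'cV[R]_N) (x0 : 'cV[R]_N)
    (m l : R -> R) : a <= 0 -> 0 <= b ->
  (forall t, 0 <= m t) -> mu.-integrable `[a, b] (EFin \o m) ->
  (forall t, 0 <= l t) -> mu.-integrable `[a, b] (EFin \o l) ->
  (forall z, ucont z -> forall i j, measurable_fun setT (fun t => G z t i j)) ->
  (forall z, ucont z -> {ae mu, forall t, a <= t <= b -> enorm (G z t) <= m t}) ->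
  (forall y z, ucont y -> ucont z -> {ae mu, forall t, a <= t <= b ->
      enorm (G y t - G z t) <= l t * enorm (y t - z t)}) ->
  exists z, [/\ ucont z, vintegrable a b (G z) &
    forall t, a <= t <= b -> z t = x0 + (prim a b (G z) t - prim a b (G z) 0)].
Proof.
move=> a0 b0 m0 im l0 il Gm Gb Gl.
have ab : a <= b by lra.
have z_ab : a <= 0 <= b by rewrite a0.
have iG z : ucont z -> vintegrable a b (G z).
  by move=> zu; apply: ae_vintegrable (Gm z zu) im (Gb z zu).
pose P z t := x0 + (prim a b (G z) t - prim a b (G z) 0).
have Pu z : ucont z -> ucont (P z).
  move=> zu; apply: ucontD; first exact: ucont_cst.
  by apply: ucontD; [apply: prim_ucont => //; exact: iG|exact: ucont_cst].
have PP y z s t : ucont y -> ucont z ->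
    (P y t - P z t) - (P y s - P z s) =
    prim a b (fun u => G y u - G z u) t - prim a b (fun u => G y u - G z u) s.
  move=> yu zu; rewrite !(primB _ ab (iG _ yu) (iG _ zu)) /P.
  by apply/matrixP => i j; rewrite !mxE; lra.
have Pinc y z s t k : ucont y -> ucont z -> a <= s <= b -> a <= t <= b -> 0 <= k ->
    (forall r, between s t r -> enorm (y r - z r) <= k) ->
    enorm ((P y t - P z t) - (P y s - P z s)) <=
    k * \int[mu]_(u in `[Num.min s t, Num.max s t]) l u.
  move=> yu zu sab tab k0 yz; rewrite PP//.
  have il' : mu.-integrable `[a, b] (EFin \o (fun u => k * l u)).
    have := integrableZl (mu := mu) (measurable_itv _) k il.
    by apply: eq_integrable => // u _ /=; rewrite EFinM.
  rewrite -RintegralZl//; last first.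
    apply: integrable_subitv il; rewrite ?le_min ?ge_max; lra.
  apply: enorm_prim_le => //.
  - by apply: vintegrableB; exact: iG.
  - by move=> r; rewrite mulr_ge0.
  apply: ae_mono (Gl y z yu zu) => r h rab rst.
  by apply: le_trans (h rab) _; rewrite mulrC ler_wpM2r// yz.
have P00 y : P y 0 = x0 by rewrite /P subrr addr0.
pose Z := fix Z k := if k is k'.+1 then P (Z k') else (fun=> x0).
have Zu k : ucont (Z k) by elim: k => [|k IH]; [exact: ucont_cst|exact: Pu].
have Z0 k : Z k 0 = x0 by case: k => [//|k]; exact: P00.
have Zclamp k t : Z k (clamp a b t) = Z k t.
  by case: k => [//|k]; rewrite /= /P prim_clamp.
have [|d d0 ld] := integrable_equicontinuous il (_ : 0 < 1 / 4).
  by rewrite divr_gt0.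
pose D := \int[mu]_(u in `[a, b]) m u.
have D0 : 0 <= D by apply: Rintegral_ge0 => t _; exact: m0.
(* Halving [d] turns the strict length condition into the weak one of [weighted_step]. *)
have d2 : 0 < d / 2 by rewrite divr_gt0.
have half_l s t : a <= s <= b -> a <= t <= b -> `|t - s| <= d / 2 ->
    \int[mu]_(u in `[Num.min s t, Num.max s t]) l u <= 1 / 4.
  move=> sab tab; rewrite ler_norml => std.
  have h r1 r2 : a <= r1 -> r1 <= r2 -> r2 <= b -> r2 - r1 < d ->
      \int[mu]_(u in `[r1, r2]) l u <= 1 / 4.
    move=> h1 h2 h3 h4; apply: le_trans (ltW (ld _ _ h1 h2 h3 h4)).
    by under [leRHS]eq_Rintegral do rewrite ger0_norm//.
  by case: (leP s t) => st; apply: h; lra.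
have incr k : forall t, a <= t <= b ->
    enorm (Z k.+1 t - Z k t) <= D / 2 ^+ k * weight (d / 2) t.
  elim: k => [|k IH] t tab.
    rewrite expr0 divr1; apply: (@le_trans _ _ D); last by rewrite ler_peMr// weight_ge1.
    rewrite /= /P addrC addKr.
    apply: le_trans (enorm_prim_le z_ab tab (iG _ (Zu 0%N)) m0 im _) _.
      by apply: ae_mono (Gb _ (Zu 0%N)) => r h rab _; exact: h.
    apply: fine_le => //.
    - apply: integrable_fin_num => //; apply: integrable_subitv im; rewrite ?le_min ?ge_max; lra.
    - exact: integrable_fin_num.
    - apply: ge0_le_integral_nomeas => [u /=|u _|u _|u _]; rewrite ?lee_fin//.
      by rewrite !in_itv /=; case: (leP 0 t) => ?; lra.
  have c0 : 0 <= D / 2 ^+ k by rewrite divr_ge0// exprn_ge0.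
  have u0 : enorm (Z k.+2 0 - Z k.+1 0) <= 0 by rewrite !Z0 subrr enorm0.
  (* All iterates equal [x0] at time 0, so [weighted_step] is used with B = 0. *)
  rewrite (_ : D / 2 ^+ k.+1 = D / 2 ^+ k / 2 + 2 * 0); last first.
    by rewrite mulr0 addr0 exprS; field; rewrite expf_neq0.
  apply: (@weighted_step _ a b (d / 2) 0 (D / 2 ^+ k)
    (fun t => enorm (Z k.+2 t - Z k.+1 t)) (fun t => enorm (Z k.+1 t - Z k t))
    a0 b0 d2 (lexx 0) c0 u0 IH _ t tab) => {c0}.
  move=> s r c sab rab srd c0 vc; rewrite addr0.
  have h1 := Pinc (Z k.+1) (Z k) s r c (Zu _) (Zu _) sab rab c0 vc.
  have h2 := ler_wpM2l c0 (half_l s r sab rab srd).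
  apply: le_trans (enorm_le_subD _ (Z k.+2 s - Z k.+1 s)) _.
  by rewrite addrC lerD2l (le_trans h1)// (le_trans h2)// mul1r.
(* [W] bounds the weight on [a, b]. The iterates are constant on either side of [a, b], so their
   increments decay geometrically on the whole line. *)
pose W := 4 ^+ Num.truncn ((b - a) / (d / 2)) : R.
have [|z [C zC]] := @geometric_limit_mx _ _ Z (D * W).
  move=> k t; rewrite -(Zclamp k.+1 t) -(Zclamp k t).
  have tab := clamp_itv t ab; apply: le_trans (incr k _ tab) _.
  rewrite [D * W / _]mulrAC ler_wpM2l ?divr_ge0 ?exprn_ge0//.
  by apply: weight_le => //; rewrite ler_norml; lra.
have zu : ucont z.
  apply: ucont_lim Zu _ => e e0; have [k ke] := exists_geometric_lt C e0.
  by exists k => t; exact: le_trans (zC k t) ke.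
exists z; split => //; first exact: iG.
move=> t tab; apply/eqP; rewrite -subr_eq0; apply/eqP/enorm_le0.
pose L := \int[mu]_(u in `[Num.min 0 t, Num.max 0 t]) l u.
(* The limit is within C/2^k of Z_(k+1) = P Z_k, which is itself within C L/2^k of P z. *)
apply: (@le_geometric0 _ _ (C + C * L)) => k.
have Ck : 0 <= C / 2 ^+ k by exact: le_trans (enorm_ge0 _) (zC k 0).
have := Pinc (Z k) z 0 t (C / 2 ^+ k) (Zu k) zu z_ab tab Ck (fun r _ => zC k r).
rewrite !P00 subrr subr0 -/L => h1.
apply: le_trans (enorm_sub_trans (z t) (Z k.+1 t) (P z t)) _.
rewrite mulrDl [C * L / _]mulrAC; apply: lerD; last exact: h1.
rewrite enormBC (le_trans (zC k.+1 t))// exprS invfM mulrCA ler_piMl//.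
by rewrite invf_le1// ler1n.
Qed.

End Picard.

(** * Equicontinuous bounds and uniformly small primitives *)

Section Equicontinuity.
Context {R : realType}.
Notation mu := (@lebesgue_measure R).

(** The interval is crossed in at most K steps of length at most d. Each costs A, whereas the
    increments of v telescope and are not multiplied by K. *)
Lemma chain_steps (a b d : R) : 0 < d -> exists K : nat,
  forall (u v : R -> R) (A : R), 0 <= A ->
    (forall s t, a <= s -> s <= t -> t <= b -> t - s <= d ->
       u t <= u s + A + (v t - v s)) ->
    forall t, a <= t <= b -> u t <= u a + K%:R * A + (v t - v a).
Proof.
move=> d0; exists (Num.truncn ((b - a) / d)).+1 => u v A A0 ust.
have key (k : nat) : forall t, a <= t <= b -> t - a <= k%:R * d ->
    u t <= u a + k%:R * A + (v t - v a).
  elim: k => [|k IH] t tab tk.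
    have -> : t = a by move: tk; rewrite mul0r; lra.
    by rewrite mul0r subrr !addr0.
  have kS : k.+1%:R = k%:R + 1 :> R by rewrite -natr1.
  rewrite kS mulrDl mul1r in tk *.
  have kA : 0 <= k%:R * A by rewrite mulr_ge0.
  have [td|td] := leP (t - a) d.
    by have := ust a t; rewrite lexx => /(_ isT); lra.
  have := IH (t - d); have := ust (t - d) t; lra.
move=> t tab; apply: key => //; rewrite -ler_pdivrMr//.
rewrite (le_trans _ (ltW (truncnS_gt _)))// ler_pM2r ?invr_gt0//; lra.
Qed.

Lemma ucont_bounded p q (a b : R) (y : R -> 'M[R]_(p, q)) : ucont y ->
  exists2 Y, 0 <= Y & forall t, a <= t <= b -> enorm (y t) <= Y.
Proof.
move=> yu; have [d d0 yd] := yu 1 ltr01.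
have d2 : 0 < d / 2 by rewrite divr_gt0.
have [K KP] := chain_steps a b d2.
exists (enorm (y a) + K%:R * 1); first by rewrite addr_ge0 ?enorm_ge0 ?mulr_ge0.
move=> t tab; have := KP (fun t => enorm (y t)) (fun=> 0) 1 ler01 _ t tab.
rewrite subrr addr0; apply=> s r as_ sr rb srd; rewrite ?subrr ?addr0 addrC.
apply: le_trans (enorm_le_subD (y r) (y s)) _; rewrite lerD2r; apply: yd.
by rewrite ger0_norm; lra.
Qed.

(** The equicontinuity condition on one interval, for an indexed family, with weak inequalities that
    chain directly. *)
Definition equi (I : Type) (a b : R) (m : I -> R -> R) :=
  [/\ forall n, mu.-integrable `[a, b] (EFin \o m n), forall n t, 0 <= m n t &
   forall e : R, 0 < e -> exists2 d : R, 0 < d & forall n s t,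
     a <= s -> s <= t -> t <= b -> t - s <= d -> \int[mu]_(u in `[s, t]) m n u <= e].

Lemma equi_bounded (I : Type) a b (m : I -> R -> R) : a <= b -> equi a b m ->
  exists2 M : R, 0 <= M & forall n, \int[mu]_(u in `[a, b]) m n u <= M.
Proof.
move=> ab [im m0 md]; have [d d0 h] := md 1 ltr01.
have [K KP] := chain_steps a b d0.
exists (K%:R * 1) => [|n]; first by rewrite mulr_ge0.
have := KP (fun t => \int[mu]_(u in `[a, t]) m n u) (fun=> 0) 1 ler01 _ b.
rewrite ab lexx set_itv1 Rintegral_set1 subrr addr0 add0r; apply=> // s t as_ st tb std.
rewrite ?subrr ?addr0 (Rintegral_cat as_ st); last exact: integrable_subitv (im n).
by rewrite lerD2l h.
Qed.

Lemma equi_cst (I : Type) a b (m : R -> R) : (forall t, 0 <= m t) ->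
  mu.-integrable `[a, b] (EFin \o m) -> equi a b (fun _ : I => m).
Proof.
move=> m0 im; split => // e e0; have [d d0 md] := integrable_equicontinuous im e0.
exists (d / 2) => [|_ s t as_ st tb std]; first by rewrite divr_gt0.
have /ltW : \int[mu]_(u in `[s, t]) `|m u| < e by apply: md => //; lra.
by under eq_Rintegral do rewrite ger0_norm//.
Qed.

Lemma equiD (I : Type) a b (m m' : I -> R -> R) : equi a b m -> equi a b m' ->
  equi a b (fun n t => m n t + m' n t).
Proof.
move=> [im m0 md] [im' m0' md']; split.
- move=> n; have := integrableD (mu := mu) (measurable_itv _) (im n) (im' n).
  by apply: eq_integrable => // t _ /=; rewrite EFinD.
- by move=> n t; rewrite addr_ge0.
move=> e e0; have e2 : 0 < e / 2 by rewrite divr_gt0.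
have [d d0 h] := md _ e2; have [d' d0' h'] := md' _ e2.
exists (Num.min d d') => [|n s t as_ st tb]; first by rewrite lt_min d0.
rewrite le_min => /andP[hd hd'].
rewrite RintegralD//; [|exact: integrable_subitv (im n)|exact: integrable_subitv (im' n)].
by have := h n s t as_ st tb hd; have := h' n s t as_ st tb hd'; lra.
Qed.

Lemma Lloc_equicont_equi (I : Type) a b (S : set (R -> R)) (m : I -> R -> R) : a <= b ->
  Lloc_equicont S -> (forall n, S (m n)) -> equi a b m.
Proof.
move=> ab [S1 S2] Sm; split => [n|n t|e e0]; first by have [L _] := S1 _ (Sm n); exact: L.
  by have [_ ->] := S1 _ (Sm n).
pose r := `|a| + `|b| + 1; have [||d d0 Sd] := S2 r e => //.
  by rewrite /r ltr_pwDr// addr_ge0.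
exists (d / 2) => [|n s t as_ st tb std]; first by rewrite divr_gt0.
have := ler_norm a; have := ler_norm (- a); have := ler_norm b; have := ler_norm (- b).
rewrite !normrN => *; apply: ltW; apply: Sd (Sm n) _ _ _ _ _ _ => //; rewrite /r; lra.
Qed.

Lemma near_forall_lt (P : nat -> nat -> Prop) :
  (forall i, \forall n \near \oo, P i n) ->
  forall k, \forall n \near \oo, forall i, (i < k)%N -> P i n.
Proof.
move=> h; elim=> [|k IH]; first by apply: nearW.
apply: filterS2 IH (h k) => n Hn Pk i; rewrite ltnS leq_eqVlt => /predU1P[->//|].
exact: Hn.
Qed.

(* Smallness at the finitely many points of a rational grid propagates between
   grid points by equicontinuity. *)
Lemma equi_prim_small p q (q1 q2 : rat) (g : nat -> R -> 'M[R]_(p, q)) m :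
  q1 < q2 -> equi (ratr q1) (ratr q2) m ->
  (forall n, vintegrable (ratr q1) (ratr q2) (g n)) ->
  (forall n, {ae mu, forall t, ratr q1 <= t <= ratr q2 -> enorm (g n t) <= m n t}) ->
  (forall r : rat, q1 < r -> r <= q2 -> forall e : R, 0 < e ->
     \forall n \near \oo, enorm (vint (ratr q1) (ratr r) (g n)) <= e) ->
  forall e : R, 0 < e -> \forall n \near \oo,
    forall t, ratr q1 <= t <= ratr q2 ->
      enorm (prim (ratr q1) (ratr q2) (g n) t) <= e.
Proof.
move=> q12 [im m0 md] ig gm gr e e0.
have e2 : 0 < e / 2 by rewrite divr_gt0.
have [d d0 h] := md _ e2.
set a := ratr q1 in im md ig gm gr h *; set b := ratr q2 in im md ig gm gr h *.
have ab : a < b by rewrite ltr_rat.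
(* The mesh (q2 - q1)/K is at most d; the grid points are rational because [gr] concerns rational
   endpoints only. *)
pose K := (Num.truncn ((b - a) / d)).+1.
pose dq : rat := (q2 - q1) / K%:R.
have dq0 : 0 < dq by rewrite divr_gt0 ?subr_gt0.
have dqd : ratr dq <= d.
  rewrite /dq fmorph_div /= rmorphB /= ratr_nat -/a -/b ler_pdivrMr//.
  by rewrite mulrC -ler_pdivrMr// ltW// truncnS_gt.
have dqR : 0 < ratr dq :> R by rewrite ltr0q.
pose x i : rat := q1 + i%:R * dq.
have xR i : ratr (x i) = a + i%:R * ratr dq :> R.
  by rewrite /x rmorphD /= rmorphM /= ratr_nat.
pose P i n := x i <= q2 -> enorm (vint a (ratr (x i)) (g n)) <= e / 2.
have nP i : \forall n \near \oo, P i n.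
  have [xi|xi] := leP (x i) q2; last first.
    by apply: nearW => n; rewrite /P leNgt xi.
  (* [gr] excludes r = q1, where the integral is over a single point and vanishes. *)
  case: i xi => [|i] xi.
    apply: nearW => n _; rewrite xR mul0r addr0 vint_set1 enorm0; exact: ltW.
  have h1 : q1 < x i.+1 by rewrite /x ltrDl mulr_gt0.
  by apply: filterS (gr _ h1 xi _ e2) => n hn _; exact: hn.
(* There are K + 1 grid points, both ends included; t = b uses the last one. *)
have nPK := near_forall_lt nP K.+1.
apply: filterS nPK => n hn t tab.
pose i := Num.truncn ((t - a) / ratr dq).
have ti0 : 0 <= (t - a) / ratr dq by rewrite divr_ge0 ?(ltW dqR)//; lra.
have /andP[i1 i2] := truncn_itv ti0.
rewrite ler_pdivlMr// in i1; rewrite ltr_pdivrMr// -natr1 mulrDl mul1r in i2.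
have xt : ratr (x i) <= t by rewrite xR /i; lra.
have ax : a <= ratr (x i) by rewrite xR lerDl mulr_ge0 ?(ltW dqR).
have tx : t - ratr (x i) <= d by rewrite xR /i; lra.
have xb : ratr (x i) <= b by lra.
have xq : x i <= q2 by rewrite -(ler_rat R).
have iK : (i < K.+1)%N.
  have : (ratr (x i) : R) <= a + K%:R * ratr dq.
    apply: le_trans xb _; rewrite /dq fmorph_div /= rmorphB /= ratr_nat -/a -/b.
    by rewrite mulrC divfK ?pnatr_eq0//; lra.
  by rewrite xR lerD2l ler_pM2r// ler_nat ltnS.
have tb : t <= b by lra.
have h1 : enorm (prim a b (g n) (ratr (x i))) <= e / 2.
  by rewrite /prim clamp_id; [exact: hn|rewrite ax].
have h2 : enorm (prim a b (g n) t - prim a b (g n) (ratr (x i))) <= e / 2.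
  have xab : a <= ratr (x i) <= b by rewrite ax.
  apply: le_trans (enorm_prim_le xab tab (ig n) (m0 n) (im n) _) _.
    by apply: ae_mono (gm n) => r h0 rab _; exact: h0.
  by rewrite min_l// max_r//; apply: h.
rewrite (splitr e); apply: le_trans (enorm_le_subD _ (prim a b (g n) (ratr (x i)))) _.
exact: lerD.
Qed.

Lemma vintegrable_mulmxr p q r (a b : R) (g : R -> 'M[R]_(p, q)) (v : 'M[R]_(q, r)) :
  vintegrable a b g -> vintegrable a b (fun t => g t *m v).
Proof.
move=> ig i j.
have igv k : mu.-integrable `[a, b] (EFin \o (fun t => g t i k * v k j)).
  have := integrableZr (mu := mu) (measurable_itv _) (v k j) (ig i k).
  by apply: eq_integrable => // t _ /=; rewrite EFinM.
have := (Rintegral_finsum (measurable_itv _) igv).1.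
by apply: eq_integrable => // t _ /=; rewrite mxE.
Qed.

Lemma equi_prim_mul_small p q (a b : R) (g : nat -> R -> 'M[R]_(p, q)) m
    (y : R -> 'cV[R]_q) : a <= b -> equi a b m -> ucont y ->
  (forall n, vintegrable a b (g n)) ->
  (forall n, vintegrable a b (fun t => g n t *m y t)) ->
  (forall n, {ae mu, forall t, a <= t <= b -> enorm (g n t) <= m n t}) ->
  (forall e : R, 0 < e -> \forall n \near \oo,
    forall t, a <= t <= b -> enorm (prim a b (g n) t) <= e) ->
  forall e : R, 0 < e -> \forall n \near \oo,
    forall t, a <= t <= b -> enorm (prim a b (fun u => g n u *m y u) t) <= e.
Proof.
move=> ab mE yu ig igy gm gs e e0; have [im m0 md] := mE.
have [Y Y0 yY] := ucont_bounded a b yu.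
have [M M0 mM] := equi_bounded ab mE.
(* The constants are fixed in the order w, d, K, eta. Remainders cost at most w M <= e/2 and the K
   frozen steps at most 2 K eta Y <= e/2; the added ones avoid zero denominators. *)
pose w := e / (2 * (M + 1)).
have w0 : 0 < w by rewrite divr_gt0// mulr_gt0//; lra.
have [d d0 yd] := yu _ w0.
have d2 : 0 < d / 2 by rewrite divr_gt0.
have [K KP] := chain_steps a b d2.
pose eta := e / (4 * (K%:R + 1) * (Y + 1)).
have K1 : 0 < K%:R + 1 :> R by rewrite ltr_wpDl.
have eta0 : 0 < eta by rewrite divr_gt0// !mulr_gt0//; lra.
apply: filterS (gs _ eta0) => n hn t tab.
pose Q := prim a b (fun u => g n u *m y u).
have stp s r : a <= s -> s <= r -> r <= b -> r - s <= d / 2 ->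
    enorm (Q r) <= enorm (Q s) + 2 * eta * Y +
      (w * \int[mu]_(u in `[a, r]) m n u - w * \int[mu]_(u in `[a, s]) m n u).
  move=> as_ sr rb srd.
  have sab : a <= s <= b by lra.
  have rab : a <= r <= b by lra.
  have igys : vintegrable a b (fun u => g n u *m (y u - y s)).
    apply: (@eq_vintegrable _ _ _ _ _ (fun u => g n u *m y u - g n u *m y s)).
      by move=> u _; rewrite mulmxBr.
    by apply: vintegrableB => //; exact: vintegrable_mulmxr.
  have e1 : Q r - Q s = (prim a b (g n) r - prim a b (g n) s) *m y s +
      (prim a b (fun u => g n u *m (y u - y s)) r - prim a b (fun u => g n u *m (y u - y s)) s).
    rewrite !prim_diff// -vint_mulmxr; last exact: vintegrableS (ig n).
    rewrite -vintD; last 2 first.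
    - by apply: vintegrable_mulmxr; exact: vintegrableS (ig n).
    - exact: vintegrableS igys.
    by apply: eq_vint => u _; rewrite mulmxBr addrC subrK.
  have wm0 u : 0 <= w * m n u by rewrite mulr_ge0// ltW.
  have iwm : mu.-integrable `[a, b] (EFin \o (fun u => w * m n u)).
    have := integrableZl (mu := mu) (measurable_itv _) w (im n).
    by apply: eq_integrable => // u _ /=; rewrite EFinM.
  have h2 : enorm (prim a b (fun u => g n u *m (y u - y s)) r -
      prim a b (fun u => g n u *m (y u - y s)) s) <= w * \int[mu]_(u in `[s, r]) m n u.
    rewrite -RintegralZl//; last exact: integrable_subitv (im n).
    have := enorm_prim_le sab rab igys wm0 iwm; rewrite /between min_l// max_r//; apply.
    apply: ae_mono (gm n) => u h uab usr.
    apply: le_trans (enorm_mulmx _ _) _; rewrite mulrC.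
    apply: ler_pM; rewrite ?enorm_ge0//; last exact: h.
    by apply: yd; rewrite ger0_norm; lra.
  have h1 : enorm ((prim a b (g n) r - prim a b (g n) s) *m y s) <= 2 * eta * Y.
    apply: le_trans (enorm_mulmx _ _) _; apply: ler_pM; rewrite ?enorm_ge0//; last exact: yY.
    by apply: le_trans (enormB _ _) _; have := hn _ sab; have := hn _ rab; lra.
  rewrite (Rintegral_cat as_ sr); last exact: integrable_subitv (im n).
  apply: le_trans (enorm_le_subD _ (Q s)) _.
  rewrite mulrDr [X in _ <= _ + X]addrAC subrr add0r -addrA [leLHS]addrC lerD2l e1.
  exact: le_trans (enormD _ _) (lerD h1 h2).
have eY0 : 0 <= 2 * eta * Y by rewrite mulr_ge0// mulr_ge0// ltW.
have := KP (fun r => enorm (Q r)) (fun r => w * \int[mu]_(u in `[a, r]) m n u) _ eY0 stp t tab.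
have Qa : Q a = 0 by rewrite /Q /prim clamp_id ?lexx// vint_set1.
rewrite /= Qa enorm0 set_itv1 Rintegral_set1 mulr0 subr0 add0r => /le_trans; apply.
have b1 : K%:R * (2 * eta * Y) <= e / 2.
  rewrite (_ : K%:R * _ = e / 2 * (K%:R / (K%:R + 1) * (Y / (Y + 1)))); last first.
    by rewrite /eta; field; apply/andP; split; rewrite gt_eqF//; lra.
  rewrite ger_pMr ?divr_gt0//; apply: mulr_ile1; rewrite ?divr_ge0//; try lra.
  - by rewrite ler_pdivrMr//; lra.
  - by rewrite ler_pdivrMr//; lra.
have b2 : w * \int[mu]_(u in `[a, t]) m n u <= e / 2.
  apply: (@le_trans _ _ (w * M)); last first.
    rewrite (_ : w * M = e / 2 * (M / (M + 1))); last by rewrite /w; field; rewrite gt_eqF//; lra.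
    by rewrite ger_pMr ?divr_gt0// ler_pdivrMr//; lra.
  rewrite ler_pM2l// (le_trans _ (mM n))//.
  rewrite (@Rintegral_cat _ a t b)//; [|lra..].
  by rewrite lerDl Rintegral_ge0.
lra.
Qed.

End Equicontinuity.

(** * Truncation to a cube and the moduli built from optimal bounds *)

Section Theta.
Context {R : realType}.
Notation mu := (@lebesgue_measure R).

Lemma enorm_le_entry p q (A B : 'M[R]_(p, q)) :
  (forall i j, `|A i j| <= `|B i j|) -> enorm A <= enorm B.
Proof.
move=> AB; rewrite -(@ler_pXn2r _ 2) ?nnegrE ?enorm_ge0// !enorm_sqr.
apply: ler_sum => i _; apply: ler_sum => j _.
by rewrite -(real_normK (num_real (A i j))) -(real_normK (num_real (B i j))) ler_pXn2r ?nnegrE.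
Qed.

(** A cube rather than a ball: acting coordinate by coordinate makes the projection visibly
    1-Lipschitz for the Euclidean norm, and the image lies in the ball of radius N c. *)
Definition cube_proj N (c : nat) (x : 'cV[R]_N) : 'cV[R]_N :=
  map_mx (clamp (- c%:R) c%:R) x.

Lemma cube_proj_lip N c (x y : 'cV[R]_N) :
  enorm (cube_proj c x - cube_proj c y) <= enorm (x - y).
Proof. by apply: enorm_le_entry => i j; rewrite !mxE; exact: clamp_lip. Qed.

Lemma cube_proj_id N c (x : 'cV[R]_N) : enorm x <= c%:R -> cube_proj c x = x.
Proof.
move=> xc; apply/matrixP => i j; rewrite mxE clamp_id// -ler_norml.
exact: le_trans (entry_le_enorm _ _ _) xc.
Qed.

Lemma cube_proj_ballj N c (x : 'cV[R]_N) : ballj (N * c) (cube_proj c x).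
Proof.
rewrite /ballj /=; apply: le_trans (enorm_le_sum _) _.
rewrite natrM (_ : N%:R * _ = \sum_(i < N) c%:R); last first.
  by rewrite sumr_const card_ord mulr_natl.
apply: ler_sum => i _; rewrite big_ord1 mxE ler_norml.
by apply: clamp_itv; apply: (@le_trans _ _ 0); rewrite ?oppr_le0.
Qed.

Lemma ucont_lip p q (y z : R -> 'M[R]_(p, q)) : ucont z ->
  (forall s t, enorm (y t - y s) <= enorm (z t - z s)) -> ucont y.
Proof.
by move=> zu yz e e0; have [d d0 zd] := zu e e0; exists d => // s t /zd; exact: le_trans.
Qed.

Lemma ucont_prim_clamp p q a b (x : R -> 'M[R]_(p, q)) (A : 'M[R]_(p, q)) g :
  a <= b -> vintegrable a b g ->
  (forall t, a <= t <= b -> x t = A + prim a b g t) -> ucont (x \o clamp a b).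
Proof.
move=> ab ig xg; have pu := prim_ucont ab ig.
apply: ucont_lip pu _ => s t; rewrite /= !xg ?clamp_itv// !prim_clamp//.
by rewrite opprD addrACA subrr add0r.
Qed.

Lemma curve_vintegrable N p q (f : R -> 'cV[R]_N -> 'M[R]_(p, q)) a b j z (m : R -> R) :
  C1 f -> ucont z -> (forall t, ballj j (z t)) -> mbound f (ballj j) m ->
  mu.-integrable `[a, b] (EFin \o m) -> vintegrable a b (fun t => f t (z t)).
Proof.
move=> fC zu zj fm im; apply: (ae_vintegrable _ im).
  by move=> i k; exact: C1_curve_measurable.
by apply: ae_mono fm => t h _; exact: h.
Qed.

Lemma ballj0 N j : @ballj R N j 0.
Proof. by rewrite /ballj /= enorm0. Qed.

Lemma optbound_ge0 N p q (f : R -> 'cV[R]_N -> 'M[R]_(p, q)) j t : 0 <= optbound f j t.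
Proof.
rewrite /optbound; set S := (X in sup X).
(* A set without a supremum gets the default value 0 from [sup]. *)
have [hS|hS] := pselect (has_sup S); last by rewrite sup_out.
apply: le_trans (enorm_ge0 (f t 0)) _; apply: sup_upper_bound => //.
by exists 0 => //; exact: ballj0.
Qed.

Lemma le_optbound N p q (f : R -> 'cV[R]_N -> 'M[R]_(p, q)) j t M x :
  (forall x, ballj j x -> enorm (f t x) <= M) -> ballj j x ->
  enorm (f t x) <= optbound f j t <= M.
Proof.
move=> fM jx; apply/andP; split.
  by apply: ub_le_sup; [exists M => _ [y jy <-]; exact: fM|exists x].
by apply: ge_sup; [exists (enorm (f t x)); exists x|move=> _ [y jy <-]; exact: fM].
Qed.

Lemma Lloc_abs (m : R -> R) a b : a <= b -> Lloc m ->
  mu.-integrable `[a, b] (EFin \o (fun t => `|m t|)).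
Proof. by move=> ab mL; exact: integrable_norm (mL a b ab). Qed.

Lemma mbound_abs N p q (f : R -> 'cV[R]_N -> 'M[R]_(p, q)) K m :
  mbound f K m -> mbound f K (fun t => `|m t|).
Proof. by apply: ae_mono => t h x Kx; apply: le_trans (h x Kx) (ler_norm _). Qed.

(** The integral of the optimal bound over [s, t] belongs to the set whose supremum is [ThetaE];
    equicontinuity bounds that set, so the supremum is genuine and not a default value. *)
Lemma ThetaE_ge N p q (E : set (R -> 'cV[R]_N -> 'M[R]_(p, q))) f q1 q2 j z s t :
  eq_mbounds E -> E f -> ratr q1 <= s <= ratr q2 -> s <= t ->
  vintegrable s t (fun u => f u (z u)) -> (forall u, s <= u <= t -> ballj j (z u)) ->
  enorm (vint s t (fun u => f u (z u))) <= ThetaE E q1 q2 j (t - s).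
Proof.
move=> /(_ j)[mb [Emb ES]] Ef sq st ig zj.
have mbP f' (Ef' : E f') : Lloc (mb f') /\ (forall t, 0 <= mb f' t).
  by have [h _] := ES; apply: h; exists f'.
have opt_le f' r1 r2 : E f' -> r1 <= r2 ->
    (\int[mu]_(u in `[r1, r2]) (optbound f' j u)%:E <=
     \int[mu]_(u in `[r1, r2]) (mb f' u)%:E)%E.
  move=> Ef' r12; have [mL m0] := mbP _ Ef'; apply: ae_ge0_le_integral_nomeas => //.
  - exact: optbound_ge0.
  - exact: mL.
  apply: ae_mono (Emb _ Ef') => u h _.
  by have /andP[] := le_optbound h (ballj0 N j).
have opt_lty f' r1 r2 : E f' -> r1 <= r2 ->
    (\int[mu]_(u in `[r1, r2]) (optbound f' j u)%:E < +oo)%E.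
  move=> Ef' r12; apply: le_lt_trans (opt_le _ _ _ Ef' r12) _.
  by apply: integrable_lty => //; have [mL _] := mbP _ Ef'; exact: mL.
apply: (@le_trans _ _ (\int[mu]_(u in `[s, t]) optbound f j u)).
  apply: enorm_vint_le => //; first exact: optbound_ge0.
    exact: opt_lty.
  apply: ae_mono (Emb _ Ef) => u h ust.
  by have /andP[] := le_optbound h (zj u ust).
(* Windows of length t - s starting in [q1, q2] may leave it on the right, so the uniform mass bound
   is taken on the enlarged interval. *)
have q12 : ratr q1 <= ratr q2 + (t - s) :> R by lra.
pose m (k : {f | E f}) := mb (sval k).
have [|M M0 MP] := @equi_bounded R _ (ratr q1) (ratr q2 + (t - s)) m q12.
  by apply: Lloc_equicont_equi q12 ES _ => -[f' Ef'] /=; exists f'.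
apply: ub_le_sup; last by exists s, f; split => //; rewrite subrKC.
exists M => _ [r [f' [rq Ef' ->]]].
have rr : r <= r + (t - s) by lra.
have [mL m0] := mbP _ Ef'.
apply: le_trans (MP (exist _ f' Ef')); rewrite /m /=.
have fin1 : (\int[mu]_(u in `[r, (r + (t - s))%R]) (optbound f' j u)%:E \is a fin_num)%E.
  by rewrite ge0_fin_numE ?opt_lty// integral_ge0// => u _; rewrite lee_fin optbound_ge0.
apply: fine_le => //; first by apply: integrable_fin_num => //; exact: mL.
apply: le_trans (opt_le _ _ _ Ef' rr) _.
apply: ge0_le_integral_nomeas => [u /=|u _|u _|u _]; rewrite ?lee_fin//.
by rewrite !in_itv /=; lra.
Qed.

(** Typically [z] is a truncated solution, which may leave the cube, and [w] its projection, which
    stays in the ball and inherits the modulus because it moves no more than [z]. *)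
Lemma Kset_of_integral N (E : set (R -> 'cV[R]_N -> 'cV[R]_N)) f (q1 q2 : rat) j
    (z w : R -> 'cV[R]_N) : eq_mbounds E -> E f -> ucont w ->
  (forall t, ballj j (w t)) ->
  vintegrable (ratr q1) (ratr q2) (fun u => f u (w u)) ->
  (forall s t, ratr q1 <= s -> s <= t -> t <= ratr q2 ->
    z t - z s = vint s t (fun u => f u (w u))) ->
  (forall s t, enorm (w t - w s) <= enorm (z t - z s)) ->
  Kset (ThetaE E) q1 q2 j w.
Proof.
move=> EB Ef wu wj ig zw wz; split.
- by apply: continuous_subspaceT; exact: ucont_continuous.
- by move=> t _; exact: wj.
move=> s t; wlog st : s t / s <= t => [hw sq tq|sq tq].
  have [st|/ltW ts] := leP s t; first exact: hw.
  by rewrite enormBC distrC; exact: hw.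
apply: le_trans (wz s t) _; rewrite zw//; [|lra..].
rewrite ger0_norm ?subr_ge0//; apply: ThetaE_ge => //.
by apply: vintegrableS ig; lra.
Qed.

End Theta.

(** * Integral equations and comparison of truncated solutions with the limit *)

Section Solutions.
Context {R : realType}.
Notation mu := (@lebesgue_measure R).

Lemma subrACA (V : zmodType) (x y z t : V) : x - y - (z - t) = (x - z) - (y - t).
Proof. by rewrite !opprD !opprK addrACA. Qed.

Lemma subr_telescope (V : zmodType) (x y z x' y' z' : V) :
  x - y - (x' - y') + (y - z - (y' - z')) = (x - x') - (z - z').
Proof. by rewrite (subrACA x) (subrACA y) addrA subrK. Qed.

(** Converts domination by k m into the increment k/4 that [gronwall] absorbs. *)
Lemma enorm_prim_step p q (a b d k : R) (g : R -> 'M[R]_(p, q)) (m : R -> R) s t :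
  (forall r, 0 <= m r) -> mu.-integrable `[a, b] (EFin \o m) ->
  (forall r1 r2, a <= r1 -> r1 <= r2 -> r2 <= b -> r2 - r1 <= d ->
     \int[mu]_(u in `[r1, r2]) m u <= 1 / 4) ->
  vintegrable a b g -> a <= s <= b -> a <= t <= b -> `|t - s| <= d -> 0 <= k ->
  {ae mu, forall r, a <= r <= b -> between s t r -> enorm (g r) <= k * m r} ->
  enorm (prim a b g t - prim a b g s) <= k / 4.
Proof.
move=> m0 im md ig sab tab std k0 gm.
have ikm : mu.-integrable `[a, b] (EFin \o (fun u => k * m u)).
  have := integrableZl (mu := mu) (measurable_itv _) k im.
  by apply: eq_integrable => // u _ /=; rewrite EFinM.
have km0 u : 0 <= k * m u by rewrite mulr_ge0.
apply: le_trans (enorm_prim_le sab tab ig km0 ikm gm) _.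
have [h1 h2 h3 h4] : [/\ a <= Num.min s t, Num.max s t <= b,
    Num.min s t <= Num.max s t & Num.max s t - Num.min s t <= d].
  by move: std; rewrite ler_norml; case: (leP s t) => st std; split; lra.
rewrite RintegralZl//; last exact: integrable_subitv h1 h2 im.
rewrite (_ : k / 4 = k * (1 / 4)); last by rewrite mul1r.
by rewrite ler_wpM2l// md.
Qed.

(** The definition gives integrability on each side of 0 separately; gluing yields one primitive on
    [p1, p2] for both directions of time. *)
Lemma integral_eq_prim p q (g x : R -> 'M[R]_(p, q)) x0 (a b : \bar R) (p1 p2 : R) :
  p1 <= 0 -> 0 <= p2 -> (a < p1%:E)%E -> (p2%:E < b)%E ->
  (forall t, (a < t%:E)%E -> (t%:E < b)%E ->
    vintegrable (Num.min 0 t) (Num.max 0 t) g /\ x t = x0 + oint 0 t g) ->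
  vintegrable p1 p2 g /\
  forall t, p1 <= t <= p2 -> x t = x0 + (prim p1 p2 g t - prim p1 p2 g 0).
Proof.
move=> p10 p20 ap pb h.
have hp t : p1 <= t <= p2 -> (a < t%:E)%E /\ (t%:E < b)%E.
  move=> /andP[t1 t2]; split.
  - by apply: lt_le_trans ap _; rewrite lee_fin.
  - by apply: le_lt_trans pb; rewrite lee_fin.
have ig : vintegrable p1 p2 g.
  apply: (vintegrable_cat p10 p20).
  - have [|h1 h2] := hp p1; first by lra.
    by have [+ _] := h _ h1 h2; rewrite min_r// max_l.
  - have [|h1 h2] := hp p2; first by lra.
    by have [+ _] := h _ h1 h2; rewrite min_l// max_r.
split => // t tp; have [h1 h2] := hp t tp.
by rewrite (h t h1 h2).2 (oint_prim p10 p20 tp ig).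
Qed.

Lemma is_sol_of_prim N (f : R -> 'cV[R]_N -> 'cV[R]_N) x0 (p1 p2 : R) z :
  p1 < 0 -> 0 < p2 -> vintegrable p1 p2 (fun u => f u (z u)) ->
  (forall t, p1 <= t <= p2 -> z t = x0 + (prim p1 p2 (fun u => f u (z u)) t -
    prim p1 p2 (fun u => f u (z u)) 0)) ->
  is_sol f x0 p1%:E p2%:E z.
Proof.
move=> p10 p20 ig zP; split; rewrite ?lte_fin// => t; rewrite !lte_fin => t1 t2.
have tp : p1 <= t <= p2 by rewrite !ltW.
split; last by rewrite (oint_prim _ _ _ ig) ?(ltW p10) ?(ltW p20)// -zP.
by apply: vintegrableS ig; rewrite ?le_min ?ge_max ?(ltW p10) ?(ltW p20) !ltW.
Qed.

(** After composition with [cube_proj], bounds on a single compact ball hold along every curve, as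
    [picard] requires; absolute values make them nonnegative everywhere. *)
Lemma truncated_solution N (f : R -> 'cV[R]_N -> 'cV[R]_N) (c : nat) (a b : R) x0 :
  a <= 0 -> 0 <= b -> LC f ->
  exists z, [/\ ucont z, vintegrable a b (fun u => f u (cube_proj c (z u))) &
    forall t, a <= t <= b ->
      z t = x0 + (prim a b (fun u => f u (cube_proj c (z u))) t -
                  prim a b (fun u => f u (cube_proj c (z u))) 0)].
Proof.
move=> a0 b0 [fC f2 fl]; have ab : a <= b by lra.
have cK := @ballj_compact R N (N * c).
have [m [mL fm]] := f2 _ cK; have [l [lL lP]] := fl _ cK.
have pu z : ucont z -> ucont (fun t => cube_proj c (z t)).
  by move=> zu; apply: ucont_lip zu _ => s t; exact: cube_proj_lip.
apply: (@picard R N a b (fun z u => f u (cube_proj c (z u))) x0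
  (fun t => `|m t|) (fun t => `|l t|)) => //.
- exact: Lloc_abs.
- exact: Lloc_abs.
- by move=> z zu i j; apply: C1_curve_measurable => //; exact: pu.
- move=> z zu; apply: ae_mono (mbound_abs fm) => t h _; apply: h.
  exact: cube_proj_ballj.
- move=> y z yu zu; apply: ae_mono lP => t h _.
  have := h _ _ (cube_proj_ballj c (y t)) (cube_proj_ballj c (z t)).
  move=> /le_trans; apply.
  apply: le_trans (ler_wpM2r (enorm_ge0 _) (ler_norm (l t))) _.
  by rewrite ler_wpM2l// cube_proj_lip.
Qed.

(* Truncating f_n to a cube makes its solution z_n global; z_n stays close to x,
   hence inside the cube, where truncation changes nothing. *)
Lemma solutions_close N (E : set (R -> 'cV[R]_N -> 'cV[R]_N))
    (fn : nat -> R -> 'cV[R]_N -> 'cV[R]_N) f (x0n : nat -> 'cV[R]_N) x0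
    (a b : \bar R) x (q1 q2 : rat) :
  E `<=` @LC R N -> eq_mbounds E -> (forall n, E (fn n)) -> LC f ->
  sigma_cvg (ThetaE E) fn f -> mcvg x0n x0 -> is_sol f x0 a b x ->
  (a < (ratr q1)%:E)%E -> ((ratr q2)%:E < b)%E -> q1 < 0 -> 0 < q2 ->
  forall e : R, 0 < e -> \forall n \near \oo, exists z,
    is_sol (fn n) (x0n n) (ratr q1)%:E (ratr q2)%:E z /\
    forall t, ratr q1 <= t <= ratr q2 -> enorm (z t - x t) <= e.
Proof.
move=> ELC EB Efn fLC fnf x0nx [_ _ xsol] aq qb q10 q20 e e0.
set p1 : R := ratr q1 in aq *; set p2 : R := ratr q2 in qb *.
have p10 : p1 < 0 by rewrite /p1 ltrq0.
have p20 : 0 < p2 by rewrite /p2 ltr0q.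
have p12 : p1 <= p2 by rewrite ltW// (lt_trans p10).
have p0 : p1 <= 0 <= p2 by rewrite !ltW.
have q12 : q1 < q2 by rewrite (lt_trans q10).
have [ix xP] := integral_eq_prim (ltW p10) (ltW p20) aq qb xsol.
pose X := x \o clamp p1 p2.
have Xx t : p1 <= t <= p2 -> X t = x t by move=> tp; rewrite /X /= clamp_id.
have Xu : ucont X.
  apply: (@ucont_prim_clamp R N 1 p1 p2 x (x0 - prim p1 p2 (fun u => f u (x u)) 0) _ p12 ix).
  by move=> t tp; rewrite xP// -addrA; congr (_ + _); rewrite addrC.
have iX : vintegrable p1 p2 (fun u => f u (X u)).
  by apply: eq_vintegrable ix => u up; rewrite Xx.
have XP s t : p1 <= s <= p2 -> p1 <= t <= p2 ->
    X t - X s = prim p1 p2 (fun u => f u (X u)) t - prim p1 p2 (fun u => f u (X u)) s.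
  move=> sp tp; rewrite !Xx// !xP//.
  rewrite !(@eq_prim _ _ _ p1 p2 (fun u => f u (X u)) (fun u => f u (x u)))//; last first.
  - by move=> u up; rewrite Xx.
  - by move=> u up; rewrite Xx.
  by apply/matrixP => i j; rewrite !mxE; lra.
have [Y Y0 XY] := ucont_bounded p1 p2 Xu.
(* [c] exceeds the bound Y of X by at least 1, so the projection fixes every point within distance 1
   of the curve; the cube lies in the ball of radius [j]. *)
pose c := (Num.truncn Y).+2; pose j := (N * c)%N.
have Yc : 1 + Y <= c%:R.
  by rewrite /c -[_.+2]add1n natrD lerD2l ltW// truncnS_gt.
have X_pi t : p1 <= t <= p2 -> cube_proj c (X t) = X t.
  by move=> tp; apply: cube_proj_id; rewrite (le_trans (XY _ tp))// (le_trans _ Yc)// lerDr.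
have [fC f2 fl] := fLC; have cK := @ballj_compact R N j.
have [m [mL fm]] := f2 _ cK; have [l [lL lP]] := fl _ cK.
have [mb [Emb ES]] := EB j.
have /choice[z zP] := fun n => truncated_solution c (x0n n) (ltW p10) (ltW p20) (ELC _ (Efn n)).
pose w n t := cube_proj c (z n t).
have zu n : ucont (z n) by have [] := zP n.
have ifn n : vintegrable p1 p2 (fun u => fn n u (w n u)) by have [] := zP n.
have zE n t : p1 <= t <= p2 -> z n t = x0n n +
    (prim p1 p2 (fun u => fn n u (w n u)) t - prim p1 p2 (fun u => fn n u (w n u)) 0).
  by move=> tp; have [_ _] := zP n; apply.
have zd n s t : p1 <= s <= p2 -> p1 <= t <= p2 -> z n t - z n s =
    prim p1 p2 (fun u => fn n u (w n u)) t - prim p1 p2 (fun u => fn n u (w n u)) s.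
  by move=> sp tp; rewrite !zE//; apply/matrixP => i k; rewrite !mxE; lra.
have w_lip n s t : enorm (w n t - w n s) <= enorm (z n t - z n s) by exact: cube_proj_lip.
have wu n : ucont (w n) by exact: ucont_lip (zu n) (w_lip n).
have wj n t : ballj j (w n t) by exact: cube_proj_ballj.
have if_ n : vintegrable p1 p2 (fun u => f u (w n u)).
  by apply: (curve_vintegrable fC (wu n) (wj n) fm); exact: mL.
have mE : equi p1 p2 (fun n t => mb (fn n) t + `|m t|).
  apply: equiD; last by apply: equi_cst => //; exact: Lloc_abs.
  by apply: Lloc_equicont_equi p12 ES _ => n; exists (fn n).
pose g n u := fn n u (w n u) - f u (w n u).
have ig n : vintegrable p1 p2 (g n) by exact: vintegrableB.
have gs : forall e : R, 0 < e -> \forall n \near \oo,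
    forall t, p1 <= t <= p2 -> enorm (prim p1 p2 (g n) t) <= e.
  apply: (equi_prim_small q12 mE) => //.
    move=> n; apply: ae_mono2 (Emb _ (Efn n)) (mbound_abs fm) => t h1 h2 _.
    by apply: le_trans (enormB _ _) _; apply: lerD; [exact: h1|exact: h2].
  (* On [q1, r] sigma-convergence applies because the projected curve [w n] belongs to [Kset]. *)
  move=> r q1r rq2 e' e0'; apply: filterS (fnf q1 r j q1r e' e0') => n; apply.
  have rp2 : ratr r <= p2 by rewrite ler_rat.
  apply: (Kset_of_integral (z := z n) EB (Efn n)) => //.
    exact: vintegrableS (ifn n).
  move=> s t s1 st tr.
  have tp2 := le_trans tr rp2.
  rewrite zd ?prim_diff//; first by rewrite s1 (le_trans st).
  by rewrite tp2 (le_trans s1).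
have lE : equi p1 p2 (fun (_ : unit) t => `|l t|).
  by apply: equi_cst => //; exact: Lloc_abs.
have [il _ lEd] := lE; have [|d d0 ld] := lEd (1 / 4); first by rewrite divr_gt0.
have [K K0 KP] := gronwall (ltW p10) (ltW p20) d0.
(* The resulting bound K B is at most 1, which keeps z_n in the cube, and at most e. *)
pose B := Num.min 1 e / K.
have B0 : 0 < B by rewrite divr_gt0// lt_min ltr01.
have KB : K * B = Num.min 1 e by rewrite /B mulrC divfK ?gt_eqF.
have B2 : 0 < B / 2 by rewrite divr_gt0.
apply: filterS2 (gs _ B2) (x0nx _ B0) => n hg hx0.
have zX t : p1 <= t <= p2 -> enorm (z n t - X t) <= Num.min 1 e.
  (* This a priori bound depends on n, harmlessly since K in [gronwall] does not involve it. *)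
  have [Z Z0 zZ] := ucont_bounded p1 p2 (zu n).
  move=> tp; have := KP (fun t => enorm (z n t - X t)) B (Z + Y) (ltW B0) _ _ _ t tp.
  rewrite KB; apply.
  - by rewrite zE// subrr addr0 Xx// xP// subrr addr0.
  - by move=> r rp; apply: le_trans (enormB _ _) _; apply: lerD; [exact: zZ|exact: XY].
  move=> s r k sp rp srd k0 hk.
  apply: le_trans (enorm_le_subD _ (z n s - X s)) _.
  rewrite [leLHS]addrC -[leRHS]addrA lerD2l.
  pose h u := f u (w n u) - f u (X u).
  have ih : vintegrable p1 p2 h by exact: vintegrableB.
  (* The first primitive, of (f_n - f)(u, w_n), is small by [gs]; the second, of f(u, w_n) - f(u,
     X), is controlled by the Lipschitz factor. *)
  have -> : z n r - X r - (z n s - X s) =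
      (prim p1 p2 (g n) r - prim p1 p2 (g n) s) + (prim p1 p2 h r - prim p1 p2 h s).
    by rewrite [LHS]subrACA zd// XP// !primB// subr_telescope.
  apply: le_trans (enormD _ _) _; apply: lerD.
    rewrite (splitr B); apply: le_trans (enormB _ _) _.
    by apply: lerD; exact: hg.
  apply: (enorm_prim_step _ (il tt) (ld tt) ih sp rp srd k0) => //.
  apply: ae_mono lP => u hl up usr.
  have jX : ballj j (X u) by rewrite -X_pi//; exact: cube_proj_ballj.
  apply: le_trans (hl _ _ (wj n u) jX) _.
  apply: le_trans (ler_wpM2r (enorm_ge0 _) (ler_norm (l u))) _.
  rewrite mulrC ler_wpM2r// (le_trans _ (hk u usr))// -[X in w n u - X]X_pi//.
  exact: cube_proj_lip.
have zw t : p1 <= t <= p2 -> w n t = z n t.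
  move=> tp; apply: cube_proj_id; apply: le_trans Yc.
  apply: le_trans (enorm_le_subD _ (X t)) _; apply: lerD; last exact: XY.
  by apply: le_trans (zX _ tp) _; rewrite ge_min lexx.
exists (z n); split; last first.
  by move=> t tp; rewrite -Xx// (le_trans (zX _ tp))// ge_min lexx orbT.
apply: is_sol_of_prim => //.
  by apply: eq_vintegrable (ifn n) => u up; rewrite zw.
move=> t tp; rewrite zE// !(@eq_prim _ _ _ p1 p2 (fun u => fn n u (w n u)) (fun u => fn n u (z n u)))//.
- by move=> u up; rewrite zw.
- by move=> u up; rewrite zw.
Qed.

End Solutions.

(** * Convergence of the solutions of the nonlinear and linear problems *)

Section Convergence.
Context {R : realType}.
Notation mu := (@lebesgue_measure R).

Lemma ereal_rat_lt (a : \bar R) (r : R) : (a < r%:E)%E ->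
  exists q : rat, (a < (ratr q)%:E)%E /\ ratr q < r.
Proof.
case: a => [a| |] //= h.
  rewrite lte_fin in h; have [q] := rat_in_itvoo h.
  by rewrite in_itv /= => /andP[h1 h2]; exists q; rewrite lte_fin.
have [|q] := @rat_in_itvoo R (r - 1) r; first by rewrite ltrBlDr ltrDl.
by rewrite in_itv /= => /andP[h1 h2]; exists q; rewrite ltNyr.
Qed.

Lemma ereal_rat_gt (b : \bar R) (r : R) : (r%:E < b)%E ->
  exists q : rat, r < ratr q /\ ((ratr q)%:E < b)%E.
Proof.
case: b => [b| |] //= h.
  rewrite lte_fin in h; have [q] := rat_in_itvoo h.
  by rewrite in_itv /= => /andP[h1 h2]; exists q; rewrite lte_fin.
have [|q] := @rat_in_itvoo R r (r + 1); first by rewrite ltrDl.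
by rewrite in_itv /= => /andP[h1 h2]; exists q; rewrite ltry.
Qed.

(** The seminorms are indexed by rational intervals and the integral equations start at 0, so
    [T1, T2] is enlarged to a rational interval with 0 in its interior. *)
Lemma rat_interval_around (a b : \bar R) (T1 T2 : R) :
  (a < 0%:E)%E -> (0%:E < b)%E -> (a < T1%:E)%E -> (T2%:E < b)%E ->
  exists q1 q2 : rat, [/\ (a < (ratr q1)%:E)%E, ((ratr q2)%:E < b)%E,
    q1 < 0, 0 < q2 & ratr q1 < T1 /\ T2 < ratr q2].
Proof.
move=> a0 b0 aT Tb.
have [|q1 [aq1 q1m]] := @ereal_rat_lt a (Num.min T1 0); first by case: (leP T1 0).
have [|q2 [q2m q2b]] := @ereal_rat_gt b (Num.max T2 0); first by case: (leP T2 0).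
move: q1m q2m; rewrite lt_min gt_max => /andP[h1 h2] /andP[h3 h4].
by exists q1, q2; split => //; [rewrite -(ltrq0 R)|rewrite -(ltr0q R)].
Qed.

(** A maximal solution extends every other one: [xn n] therefore coincides with the nearby solution
    on the open interval ]q1, q2[, which contains [T1, T2]. *)
Lemma solutions_unif_cvg N (E : set (R -> 'cV[R]_N -> 'cV[R]_N)) :
  E `<=` @LC R N -> eq_mbounds E ->
  forall (fn : nat -> R -> 'cV[R]_N -> 'cV[R]_N) (f : R -> 'cV[R]_N -> 'cV[R]_N)
    (x0n : nat -> 'cV[R]_N) (x0 : 'cV[R]_N)
    (an bn : nat -> \bar R) (xn : nat -> R -> 'cV[R]_N)
    (a b : \bar R) (x : R -> 'cV[R]_N),
  (forall n, E (fn n)) -> LC f -> sigma_cvg (ThetaE E) fn f -> mcvg x0n x0 ->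
  (forall n, is_max_sol (fn n) (x0n n) (an n) (bn n) (xn n)) ->
  is_max_sol f x0 a b x ->
  forall T1 T2 : R, (a < T1%:E)%E -> T1 <= T2 -> (T2%:E < b)%E ->
    unif_cvg_on an bn xn x T1 T2.
Proof.
move=> EL EB fn f x0n x0 an bn xn a b x Efn fL fnf x0nx xnM [xS _] T1 T2 aT _ Tb e e0.
have [a0 b0 _] := xS.
have [q1 [q2 [aq qb q10 q20 [qT1 qT2]]]] := rat_interval_around a0 b0 aT Tb.
apply: filterS (solutions_close EL EB Efn fL fnf x0nx xS aq qb q10 q20 e0) => n [z [zS zx]].
have [_ /(_ _ _ _ zS)[anq qbn zxn]] := xnM n.
split.
- by apply: le_lt_trans anq _; rewrite lte_fin.
- by apply: lt_le_trans qbn; rewrite lte_fin.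
move=> t /andP[t1 t2]; have tq1 := lt_le_trans qT1 t1; have tq2 := le_lt_trans t2 qT2.
by rewrite -zxn ?lte_fin//; apply: zx; rewrite !ltW.
Qed.

Lemma ucontB p q (y z : R -> 'M[R]_(p, q)) : ucont y -> ucont z ->
  ucont (fun t => y t - z t).
Proof.
move=> yu zu; apply: ucontD => //; apply: ucont_lip zu _ => s t.
by rewrite -opprD enormN.
Qed.

Lemma ucont_entry_measurable p q (y : R -> 'M[R]_(p, q)) i j : ucont y ->
  measurable_fun setT (fun t => y t i j).
Proof.
move=> yu; apply: continuous_measurable_fun => t.
apply: (@continuous_comp _ _ _ y (fun M : 'M[R]_(p, q) => M i j)).
  exact: ucont_continuous.
exact: coord_continuous.
Qed.

Lemma vintegrable_mul_curve p q (a b : R) (g : R -> 'M[R]_(p, q)) (y : R -> 'cV[R]_q)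
    (m : R -> R) : (forall i j, measurable_fun setT (fun t => g t i j)) -> ucont y ->
  mu.-integrable `[a, b] (EFin \o m) ->
  {ae mu, forall t, a <= t <= b -> enorm (g t) <= m t} ->
  vintegrable a b (fun t => g t *m y t).
Proof.
move=> mg yu im gm; have [Y Y0 yY] := ucont_bounded a b yu.
apply: (@ae_vintegrable _ _ _ _ _ _ (fun t => Y * m t)).
- move=> i j; under eq_fun do rewrite mxE.
  apply: measurable_sum => k; apply: measurable_funM => //.
  exact: ucont_entry_measurable.
- have := integrableZl (mu := mu) (measurable_itv _) Y im.
  by apply: eq_integrable => // u _ /=; rewrite EFinM.
apply: ae_mono gm => t h tab; apply: le_trans (enorm_mulmx _ _) _; rewrite mulrC.
by apply: ler_pM; rewrite ?enorm_ge0 ?yY ?h.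
Qed.

(** The limit field need not belong to [E], so its solution gets the modulus only as a uniform limit
    of curves that have it. *)
Lemma Kset_lim N (Th : moduli) (q1 q2 : rat) j (X : R -> 'cV[R]_N) : ucont X ->
  (forall t, ballj j (X t)) ->
  (forall e : R, 0 < e -> exists2 w, Kset Th q1 q2 j w &
    forall t, ratr q1 <= t <= ratr q2 -> enorm (w t - X t) <= e) ->
  Kset Th q1 q2 j X.
Proof.
move=> Xu Xj Xw; split.
- by apply: continuous_subspaceT; exact: ucont_continuous.
- by move=> t _; exact: Xj.
move=> s t sq tq; apply/ler_addgt0Pr => e e0.
have [|w [_ _ wK] wX] := Xw (e / 2); first by rewrite divr_gt0.
have := wK s t sq tq; have := wX s sq; have := wX t tq; set T := Th _ _ _ _.
have := enorm_sub_trans (X t) (w t) (X s); have := enorm_sub_trans (w t) (w s) (X s).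
by rewrite (enormBC (X t) (w t)); lra.
Qed.

(** The difference is (H_n - H)(u, xs_n) plus H(u, xs_n) - H(u, X): sigma-convergence is uniform
    along the curves and handles the first, (W) the second. The bound [m] serves the Gronwall
    argument, [m'] the freezing of y. *)
Lemma coefficients_small N p q (Th : moduli) (D : set (R -> 'cV[R]_N -> 'M[R]_(p, q)))
    Hn H (xs : nat -> R -> 'cV[R]_N) X j (q1 q2 : rat) : q1 < q2 ->
  D `<=` WTC Th -> eq_mbounds D -> (forall n, D (Hn n)) -> WTC Th H ->
  sigma_cvg Th Hn H ->
  (forall n, ucont (xs n)) -> (forall n t, ballj j (xs n t)) ->
  ucont X -> (forall t, ballj j (X t)) ->
  (forall n r, q1 < r -> r <= q2 -> Kset Th q1 r j (xs n)) ->
  (forall r, q1 < r -> r <= q2 -> Kset Th q1 r j X) ->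
  (forall e : R, 0 < e -> \forall n \near \oo,
     forall t, ratr q1 <= t <= ratr q2 -> enorm (xs n t - X t) <= e) ->
  exists m m' : nat -> R -> R, [/\ equi (ratr q1) (ratr q2) m,
    equi (ratr q1) (ratr q2) m',
    forall n, {ae mu, forall t, ratr q1 <= t <= ratr q2 ->
      enorm (Hn n t (xs n t)) <= m n t},
    forall n, {ae mu, forall t, ratr q1 <= t <= ratr q2 ->
      enorm (Hn n t (xs n t) - H t (X t)) <= m' n t} &
    forall e : R, 0 < e -> \forall n \near \oo,
      forall t, ratr q1 <= t <= ratr q2 ->
        enorm (prim (ratr q1) (ratr q2) (fun u => Hn n u (xs n u) - H u (X u)) t) <= e].
Proof.
move=> q12 DW DB DHn [HC H2 HW] HnH xsu xsj Xu Xj xsK XK xsX.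
have p12 : ratr q1 <= ratr q2 :> R by rewrite ler_rat ltW.
have [mb [Dmb DS]] := DB j; have [m [mL Hm]] := H2 _ (@ballj_compact R N j).
have mE : equi (ratr q1) (ratr q2) (fun n => mb (Hn n)).
  by apply: Lloc_equicont_equi p12 DS _ => n; exists (Hn n).
have mE' : equi (ratr q1) (ratr q2) (fun n t => mb (Hn n) t + `|m t|).
  by apply: equiD => //; apply: equi_cst => //; exact: Lloc_abs.
have HnC n : C1 (Hn n) by have [] := DW _ (DHn n).
have [im _ _] := mE.
have iHn n : vintegrable (ratr q1) (ratr q2) (fun u => Hn n u (xs n u)).
  exact: curve_vintegrable (HnC n) (xsu n) (xsj n) (Dmb _ (DHn n)) (im n).
have iHx z : ucont z -> (forall t, ballj j (z t)) ->
    vintegrable (ratr q1) (ratr q2) (fun u => H u (z u)).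
  by move=> zu zj; apply: (curve_vintegrable HC zu zj Hm); exact: mL.
have bd n : {ae mu, forall t, ratr q1 <= t <= ratr q2 ->
    enorm (Hn n t (xs n t) - H t (X t)) <= mb (Hn n) t + `|m t|}.
  apply: ae_mono2 (Dmb _ (DHn n)) (mbound_abs Hm) => t h1 h2 _.
  by apply: le_trans (enormB _ _) _; apply: lerD; [exact: h1|exact: h2].
exists (fun n => mb (Hn n)), (fun n t => mb (Hn n) t + `|m t|); split => //.
  by move=> n; apply: ae_mono (Dmb _ (DHn n)) => t h _; exact: h.
apply: (equi_prim_small q12 mE') => // [n|r q1r rq2 e e0].
  by apply: vintegrableB => //; exact: iHx.
have e2 : 0 < e / 2 by rewrite divr_gt0.
have rp2 : ratr r <= ratr q2 :> R by rewrite ler_rat.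
have xsX' e' : 0 < e' -> \forall n \near \oo,
    forall t, ratr q1 <= t <= ratr r -> enorm (xs n t - X t) <= e'.
  move=> e0'; apply: filterS (xsX e' e0') => n h t /andP[t1 t2]; apply: h.
  by rewrite t1 (le_trans t2).
apply: filterS2 (HnH q1 r j q1r _ e2)
  (HW q1 r j q1r xs X (fun n => xsK n r q1r rq2) (XK r q1r rq2) xsX' _ e2) => n h1 h2.
have i1 := vintegrableS (lexx (ratr q1)) rp2 (iHn n).
have i2 := vintegrableS (lexx (ratr q1)) rp2 (iHx _ (xsu n) (xsj n)).
have i3 := vintegrableS (lexx (ratr q1)) rp2 (iHx _ Xu Xj).
rewrite (splitr e); apply: le_trans (lerD (h1 _ (xsK n r q1r rq2)) h2).
apply: le_trans (enormD _ _); rewrite -vintB// -vintD; last 2 first.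
- exact: vintegrableB.
- exact: vintegrableB.
rewrite (_ : vint _ _ _ = vint (ratr q1) (ratr r) (fun t => Hn n t (xs n t) - H t (X t)))//.
by apply: eq_vint => t _; rewrite addrA subrK.
Qed.

(* Gronwall for the difference of two linear problems, with the coefficients
   split as A y - A' y' + k - k' = A (y - y') + (A - A') y' + (k - k'). *)
Lemma linear_gronwall N (a b d : R) : a <= 0 -> 0 <= b -> 0 < d ->
  exists2 K : R, 0 < K & forall (A A' : R -> 'M[R]_N) (k k' y y' : R -> 'cV[R]_N)
    (m : R -> R) (B : R),
    (forall r, 0 <= m r) -> mu.-integrable `[a, b] (EFin \o m) ->
    (forall r1 r2, a <= r1 -> r1 <= r2 -> r2 <= b -> r2 - r1 <= d ->
      \int[mu]_(u in `[r1, r2]) m u <= 1 / 4) ->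
    {ae mu, forall t, a <= t <= b -> enorm (A t) <= m t} ->
    (forall i j, measurable_fun setT (fun t => A t i j)) ->
    ucont y -> ucont y' ->
    vintegrable a b (fun u => A u *m y u + k u) ->
    vintegrable a b (fun u => A' u *m y' u + k' u) ->
    vintegrable a b (fun u => (A u - A' u) *m y' u) ->
    vintegrable a b (fun u => k u - k' u) ->
    (forall s t, a <= s <= b -> a <= t <= b -> y t - y s =
      prim a b (fun u => A u *m y u + k u) t - prim a b (fun u => A u *m y u + k u) s) ->
    (forall s t, a <= s <= b -> a <= t <= b -> y' t - y' s =
      prim a b (fun u => A' u *m y' u + k' u) t -
      prim a b (fun u => A' u *m y' u + k' u) s) ->
    0 <= B -> enorm (y 0 - y' 0) <= B ->
    (forall t, a <= t <= b -> enorm (prim a b (fun u => (A u - A' u) *m y' u) t) <= B / 4) ->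
    (forall t, a <= t <= b -> enorm (prim a b (fun u => k u - k' u) t) <= B / 4) ->
    forall t, a <= t <= b -> enorm (y t - y' t) <= K * B.
Proof.
move=> a0 b0 d0; have ab := le_trans a0 b0.
have [K K0 KP] := gronwall a0 b0 d0; exists K => //.
move=> A A' k k' y y' m B m0 im md Am mA yu y'u i1 i2 i3 i4 yP y'P B0 yB h3 h4 t tab.
have [Y Y0 yY] := ucont_bounded a b (ucontB yu y'u).
apply: (KP (fun t => enorm (y t - y' t)) B Y) => // s r c sab rab srd c0 hc.
have i5 : vintegrable a b (fun u => A u *m (y u - y' u)).
  exact: vintegrable_mul_curve mA (ucontB yu y'u) im Am.
apply: le_trans (enorm_le_subD _ (y s - y' s)) _.
rewrite [leLHS]addrC -[leRHS]addrA lerD2l [B + _]addrC.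
have P u : prim a b (fun u => A u *m y u + k u) u - prim a b (fun u => A' u *m y' u + k' u) u =
    prim a b (fun u => A u *m (y u - y' u)) u +
    (prim a b (fun u => (A u - A' u) *m y' u) u + prim a b (fun u => k u - k' u) u).
  rewrite -primB// -primD// -primD//; last exact: vintegrableD.
  apply: eq_prim => // v _; rewrite mulmxBr mulmxBl [RHS]addrA.
  by rewrite [X in _ = X + _]addrA subrK opprD addrACA.
have -> : y r - y' r - (y s - y' s) =
    (prim a b (fun u => A u *m (y u - y' u)) r - prim a b (fun u => A u *m (y u - y' u)) s) +
    ((prim a b (fun u => (A u - A' u) *m y' u) r - prim a b (fun u => (A u - A' u) *m y' u) s) +
     (prim a b (fun u => k u - k' u) r - prim a b (fun u => k u - k' u) s)).
  rewrite [LHS]subrACA yP// y'P// subrACA !P opprD addrACA opprD.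
  by congr (_ + _); rewrite addrACA.
apply: le_trans (enormD _ _) _; apply: lerD.
  apply: (enorm_prim_step m0 im md i5 sab rab srd c0).
  apply: ae_mono Am => u hA uab usr; apply: le_trans (enorm_mulmx _ _) _; rewrite mulrC.
  by apply: ler_pM; rewrite ?enorm_ge0 ?hc ?hA.
apply: le_trans (enormD _ _) _.
(* Two primitives evaluated at both r and s: four terms of at most B/4 make up the allowance B. *)
apply: le_trans (lerD (enormB _ _) (enormB _ _)) _.
apply: le_trans (lerD (lerD (h3 r rab) (h3 s sab)) (lerD (h4 r rab) (h4 s sab))) _.
by move: B0 => /= _; clear; lra.
Qed.

Lemma linear_solutions_unif_cvg N (E : set (R -> 'cV[R]_N -> 'cV[R]_N))
    (B : set (R -> 'cV[R]_N -> 'M[R]_N)) (C : set (R -> 'cV[R]_N -> 'cV[R]_N)) :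
  E `<=` @LC R N -> eq_mbounds E ->
  B `<=` WTC (ThetaE E) -> eq_mbounds B ->
  C `<=` WTC (ThetaE E) -> eq_mbounds C ->
  forall (fn : nat -> R -> 'cV[R]_N -> 'cV[R]_N) (f : R -> 'cV[R]_N -> 'cV[R]_N)
    (x0n : nat -> 'cV[R]_N) (x0 : 'cV[R]_N)
    (an bn : nat -> \bar R) (xn : nat -> R -> 'cV[R]_N)
    (a b : \bar R) (x : R -> 'cV[R]_N)
    (Fn : nat -> R -> 'cV[R]_N -> 'M[R]_N) (F : R -> 'cV[R]_N -> 'M[R]_N)
    (hn : nat -> R -> 'cV[R]_N -> 'cV[R]_N) (h : R -> 'cV[R]_N -> 'cV[R]_N)
    (y0n : nat -> 'cV[R]_N) (y0 : 'cV[R]_N)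
    (yn : nat -> R -> 'cV[R]_N) (y : R -> 'cV[R]_N),
  (forall n, E (fn n)) -> LC f -> sigma_cvg (ThetaE E) fn f -> mcvg x0n x0 ->
  (forall n, is_max_sol (fn n) (x0n n) (an n) (bn n) (xn n)) ->
  is_max_sol f x0 a b x ->
  (forall n, B (Fn n)) -> WTC (ThetaE E) F -> sigma_cvg (ThetaE E) Fn F ->
  (forall n, C (hn n)) -> WTC (ThetaE E) h -> sigma_cvg (ThetaE E) hn h ->
  mcvg y0n y0 ->
  (forall n, is_lin_sol (fun t => Fn n t (xn n t)) (fun t => hn n t (xn n t))
                        (y0n n) (an n) (bn n) (yn n)) ->
  is_lin_sol (fun t => F t (x t)) (fun t => h t (x t)) y0 a b y ->
  forall T1 T2 : R, (a < T1%:E)%E -> T1 <= T2 -> (T2%:E < b)%E ->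
    unif_cvg_on an bn yn y T1 T2.
Proof.
move=> EL EB BW BB CW CB fn f x0n x0 an bn xn a b x Fn F hn h y0n y0 yn y.
move=> Efn fL fnf x0nx xnM xM BFn FW FnF Chn hW hnh y0ny ynS yS T1 T2 aT _ Tb.
have [[a0 b0 xS] _] := xM.
have [q1 [q2 [aq qb q10 q20 [qT1 qT2]]]] := rat_interval_around a0 b0 aT Tb.
set p1 : R := ratr q1 in aq qT1 *; set p2 : R := ratr q2 in qb qT2 *.
have p10 : p1 < 0 by rewrite /p1 ltrq0.
have p20 : 0 < p2 by rewrite /p2 ltr0q.
have p12 : p1 <= p2 by rewrite ltW// (lt_trans p10).
have p0 : p1 <= 0 <= p2 by rewrite !ltW.
have q12 : q1 < q2 by rewrite (lt_trans q10).
have U := solutions_unif_cvg EL EB Efn fL fnf x0nx xnM xM aq p12 qb.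
have curve p q (g v : R -> 'M[R]_(p, q)) v0 :
    vintegrable p1 p2 g ->
    (forall t, p1 <= t <= p2 -> v t = v0 + (prim p1 p2 g t - prim p1 p2 g 0)) ->
    ucont (v \o clamp p1 p2) /\
    forall s t, p1 <= s <= p2 -> p1 <= t <= p2 ->
      (v \o clamp p1 p2) t - (v \o clamp p1 p2) s = prim p1 p2 g t - prim p1 p2 g s.
  move=> ig vP; split.
    apply: (@ucont_prim_clamp R p q p1 p2 v (v0 - prim p1 p2 g 0) _ p12 ig).
    by move=> t tp; rewrite vP// -addrA; congr (_ + _); rewrite addrC.
  move=> s t sp tp; rewrite /= !clamp_id// !vP// opprD addrACA subrr add0r.
  by rewrite opprD opprK addrACA [- _ + _]addrC subrr addr0.
have [ix xP] := integral_eq_prim (ltW p10) (ltW p20) aq qb xS.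
pose X := x \o clamp p1 p2; have [Xu _] := curve _ _ _ _ _ ix xP.
have [Y Y0 XY] := ucont_bounded p1 p2 Xu.
pose j := (Num.truncn Y).+2.
have Yj : 1 + Y <= j%:R by rewrite /j -[_.+2]add1n natrD lerD2l ltW// truncnS_gt.
have XY' t : enorm (X t) <= Y.
  have tp := clamp_itv t p12; have := XY _ tp; rewrite /X /=.
  by rewrite (clamp_id tp).
have Xj t : ballj j (X t).
  by rewrite /ballj /= (le_trans (XY' t))// (le_trans _ Yj)// lerDr.
pose good n := [/\ (an n < p1%:E)%E, (p2%:E < bn n)%E &
  forall t, p1 <= t <= p2 -> enorm (xn n t - x t) <= 1].
(* For the finitely many indices that are not good, [xs n] is X, so that the hypotheses on the
   curves hold for every n. *)
pose xs n := if pselect (good n) then xn n \o clamp p1 p2 else X.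
have xsg n : good n -> xs n = xn n \o clamp p1 p2 by rewrite /xs; case: pselect.
have gx n : good n -> [/\ ucont (xn n \o clamp p1 p2),
    (forall t, ballj j ((xn n \o clamp p1 p2) t)) &
    forall r, q1 < r -> r <= q2 -> Kset (ThetaE E) q1 r j (xn n \o clamp p1 p2)].
  move=> [an1 bn2 xn1]; have [[_ _ xnS] _] := xnM n.
  have [ixn xnP] := integral_eq_prim (ltW p10) (ltW p20) an1 bn2 xnS.
  have [xnu xnd] := curve _ _ _ _ _ ixn xnP.
  have xnj t : ballj j ((xn n \o clamp p1 p2) t).
    rewrite /ballj /=; apply: le_trans Yj.
    apply: le_trans (enorm_le_subD _ (X t)) _; apply: lerD => //.
    by apply: xn1; exact: clamp_itv.
  split => // r q1r rq2; have rp2 : ratr r <= p2 by rewrite ler_rat.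
  have ixn' : vintegrable p1 p2 (fun u => fn n u ((xn n \o clamp p1 p2) u)).
    by apply: eq_vintegrable ixn => u up; rewrite /= clamp_id.
  apply: (Kset_of_integral (z := xn n \o clamp p1 p2) EB (Efn n)) => //.
    exact: vintegrableS ixn'.
  move=> s t s1 st tr; have tp2 := le_trans tr rp2.
  have sp : p1 <= s <= p2 by rewrite s1 (le_trans st).
  have tp : p1 <= t <= p2 by rewrite tp2 (le_trans s1).
  rewrite xnd// prim_diff//; apply: eq_vint => u /andP[su ut].
  by rewrite /= clamp_id// (le_trans s1 su) (le_trans ut).
have ngood : \forall n \near \oo, good n by exact: U ltr01.
have XK r : q1 < r -> r <= q2 -> Kset (ThetaE E) q1 r j X.
  move=> q1r rq2; apply: Kset_lim => // e e0.
  have [n [gn [_ _ hn']]] := filter_ex (filterI ngood (U e e0)).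
  exists (xn n \o clamp p1 p2); first by have [_ _] := gx n gn; apply.
  by move=> t _; apply: hn'; exact: clamp_itv.
have xsP n : [/\ ucont (xs n), (forall t, ballj j (xs n t)) &
    forall r, q1 < r -> r <= q2 -> Kset (ThetaE E) q1 r j (xs n)].
  by rewrite /xs; case: (pselect (good n)) => [gn|_] /=; [exact: gx|split].
have xsu n : ucont (xs n) by have [] := xsP n.
have xsj n t : ballj j (xs n t) by have [_ + _] := xsP n; apply.
have xsK n r : q1 < r -> r <= q2 -> Kset (ThetaE E) q1 r j (xs n).
  by have [_ _] := xsP n; apply.
have xsX (e : R) : 0 < e -> \forall n \near \oo,
    forall t, p1 <= t <= p2 -> enorm (xs n t - X t) <= e.
  move=> e0; apply: filterS2 ngood (U e e0) => n gn [_ _ hn'] t tp.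
  by rewrite xsg// /X /= clamp_id//; exact: hn'.
have [mF [mF' [mFE mFE' Fb Fb' Fs]]] :=
  coefficients_small q12 BW BB BFn FW FnF xsu xsj Xu Xj xsK XK xsX.
have [mh [mh' [mhE mhE' hb hb' hs]]] :=
  coefficients_small q12 CW CB Chn hW hnh xsu xsj Xu Xj xsK XK xsX.
have [FC _ _] := FW; have [hC _ _] := hW.
have FnC n : C1 (Fn n) by have [] := BW _ (BFn n).
have hnC n : C1 (hn n) by have [] := CW _ (Chn n).
have mFn n i k : measurable_fun setT (fun t => Fn n t (xs n t) i k).
  exact: C1_curve_measurable.
have mD p q (Gn : R -> 'cV[R]_N -> 'M[R]_(p, q)) G n : C1 Gn -> C1 G -> forall i k,
    measurable_fun setT (fun t => (Gn t (xs n t) - G t (X t)) i k).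
  move=> GnC GC i k; under eq_fun do rewrite !mxE.
  by apply: measurable_funB; exact: C1_curve_measurable.
have [imF mF0 mFd] := mFE; have [imF' _ _] := mFE'; have [imh' _ _] := mhE'.
have iFd n : vintegrable p1 p2 (fun t => Fn n t (xs n t) - F t (X t)).
  exact: ae_vintegrable (mD _ _ _ _ n (FnC n) FC) (imF' n) (Fb' n).
have ihd n : vintegrable p1 p2 (fun t => hn n t (xs n t) - h t (X t)).
  exact: ae_vintegrable (mD _ _ _ _ n (hnC n) hC) (imh' n) (hb' n).
have [iy yP] := integral_eq_prim (ltW p10) (ltW p20) aq qb yS.
pose y' := y \o clamp p1 p2; have [y'u y'd] := curve _ _ _ _ _ iy yP.
have eqy u : p1 <= u <= p2 -> F u (x u) *m y u + h u (x u) = F u (X u) *m y' u + h u (X u).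
  by move=> up; rewrite /X /y' /= clamp_id.
have iFy n : vintegrable p1 p2 (fun t => (Fn n t (xs n t) - F t (X t)) *m y' t).
  exact: vintegrable_mul_curve (mD _ _ _ _ n (FnC n) FC) y'u (imF' n) (Fb' n).
have Fys := equi_prim_mul_small p12 mFE' y'u iFd iFy Fb' Fs.
(* Equicontinuity makes [d], and hence the Gronwall constant [K], common to all n. *)
have [|d d0 dP] := mFd (1 / 4); first by rewrite divr_gt0.
have [K K0 KP] := linear_gronwall N (ltW p10) (ltW p20) d0.
move=> e e0; pose b0' := e / K.
have B0 : 0 < b0' by rewrite divr_gt0.
have B4 : 0 < b0' / 4 by rewrite divr_gt0.
have near1 : \forall n \near \oo, good n /\ enorm (y0n n - y0) <= b0'.
  by apply: filterS2 ngood (y0ny _ B0) => n; split.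
apply: filterS3 near1 (Fys _ B4) (hs _ B4) => n [gn hy0] hF hh.
have [an1 bn2 _] := gn.
have [iyn ynP] := integral_eq_prim (ltW p10) (ltW p20) an1 bn2 (ynS n).
pose yn' := yn n \o clamp p1 p2; have [yn'u yn'd] := curve _ _ _ _ _ iyn ynP.
(* For good n the curve [xs n] agrees with [xn n] on the interval, so [yn'] solves the linear
   problem with coefficients along [xs n]. *)
have eqyn u : p1 <= u <= p2 -> Fn n u (xn n u) *m yn n u + hn n u (xn n u) =
    Fn n u (xs n u) *m yn' u + hn n u (xs n u).
  by move=> up; rewrite xsg// /yn' /= clamp_id.
have est t : p1 <= t <= p2 -> enorm (yn' t - y' t) <= K * b0'.
  apply: (KP (fun u => Fn n u (xs n u)) (fun u => F u (X u))
    (fun u => hn n u (xs n u)) (fun u => h u (X u)) yn' y' (mF n) b0') => //.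
  - exact: dP.
  - exact: eq_vintegrable iyn.
  - exact: eq_vintegrable iy.
  - by move=> s r sp rp; rewrite yn'd//; congr (_ - _); exact: eq_prim.
  - by move=> s r sp rp; rewrite y'd//; congr (_ - _); exact: eq_prim.
  - exact: ltW.
  - by rewrite /yn' /y' /= clamp_id// ynP// yP// !subrr !addr0.
split.
- by apply: lt_trans an1 _; rewrite lte_fin.
- by apply: lt_trans bn2; rewrite lte_fin.
move=> t /andP[t1 t2]; have tp : p1 <= t <= p2.
  by rewrite (le_trans (ltW qT1) t1) (le_trans t2 (ltW qT2)).
by have := est t tp; rewrite /yn' /y' /= clamp_id// /b0' mulrC divfK ?gt_eqF.
Qed.

End Convergence.

Theorem theorem3p7 (R : realType) (N : nat)
  (E : set (R -> 'cV[R]_N -> 'cV[R]_N))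
  (B : set (R -> 'cV[R]_N -> 'M[R]_N))
  (C : set (R -> 'cV[R]_N -> 'cV[R]_N)) :
  E `<=` @LC R N -> eq_mbounds E ->
  B `<=` WTC (ThetaE E) -> eq_mbounds B ->
  C `<=` WTC (ThetaE E) -> eq_mbounds C ->
  (* (i) *)
  (forall (fn : nat -> R -> 'cV[R]_N -> 'cV[R]_N) (f : R -> 'cV[R]_N -> 'cV[R]_N)
          (x0n : nat -> 'cV[R]_N) (x0 : 'cV[R]_N)
          (an bn : nat -> \bar R) (xn : nat -> R -> 'cV[R]_N)
          (a b : \bar R) (x : R -> 'cV[R]_N),
     (forall n, E (fn n)) -> LC f -> sigma_cvg (ThetaE E) fn f -> mcvg x0n x0 ->
     (forall n, is_max_sol (fn n) (x0n n) (an n) (bn n) (xn n)) ->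
     is_max_sol f x0 a b x ->
     forall T1 T2 : R, (a < T1%:E)%E -> T1 <= T2 -> (T2%:E < b)%E ->
       unif_cvg_on an bn xn x T1 T2) /\
  (* (ii) *)
  (forall (fn : nat -> R -> 'cV[R]_N -> 'cV[R]_N) (f : R -> 'cV[R]_N -> 'cV[R]_N)
          (x0n : nat -> 'cV[R]_N) (x0 : 'cV[R]_N)
          (an bn : nat -> \bar R) (xn : nat -> R -> 'cV[R]_N)
          (a b : \bar R) (x : R -> 'cV[R]_N)
          (Fn : nat -> R -> 'cV[R]_N -> 'M[R]_N) (F : R -> 'cV[R]_N -> 'M[R]_N)
          (hn : nat -> R -> 'cV[R]_N -> 'cV[R]_N) (h : R -> 'cV[R]_N -> 'cV[R]_N)
          (y0n : nat -> 'cV[R]_N) (y0 : 'cV[R]_N)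
          (yn : nat -> R -> 'cV[R]_N) (y : R -> 'cV[R]_N),
     (forall n, E (fn n)) -> LC f -> sigma_cvg (ThetaE E) fn f -> mcvg x0n x0 ->
     (forall n, is_max_sol (fn n) (x0n n) (an n) (bn n) (xn n)) ->
     is_max_sol f x0 a b x ->
     (forall n, B (Fn n)) -> WTC (ThetaE E) F -> sigma_cvg (ThetaE E) Fn F ->
     (forall n, C (hn n)) -> WTC (ThetaE E) h -> sigma_cvg (ThetaE E) hn h ->
     mcvg y0n y0 ->
     (forall n, is_lin_sol (fun t => Fn n t (xn n t)) (fun t => hn n t (xn n t))
                           (y0n n) (an n) (bn n) (yn n)) ->
     is_lin_sol (fun t => F t (x t)) (fun t => h t (x t)) y0 a b y ->
     forall T1 T2 : R, (a < T1%:E)%E -> T1 <= T2 -> (T2%:E < b)%E ->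
       unif_cvg_on an bn yn y T1 T2).
Proof.
move=> EL EB BW BB CW CB; split; first exact: solutions_unif_cvg.
exact: linear_solutions_unif_cvg.
Qed.
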